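(* Let $p$ be a prime, $S$ a finite $p$-group and $\mathcal{F}$ a saturated fusion system on $S$. To each $\mathcal{F}$-conjugacy class of subgroups $(P)_{\mathcal{F}}\in Cl(\mathcal{F})$ there is associated an $\mathcal{F}$-semicharacteristic biset $\Omega_P$ such that, choosing the representative $P$ to be fully $\mathcal{F}$-normalized, $\Omega_P$ is the smallest $\mathcal{F}$-semicharacteristic biset containing $[P,\iota_P^S]$ as an orbit (i.e. it contains such an orbit and is, up to isomorphism, contained in every $\mathcal{F}$-semicharacteristic biset that does). The bisets $\Omega_P$, taken over all $(P)_{\mathcal{F}}\in Cl(\mathcal{F})$, form an additive basis for the commutative monoid (under disjoint union) of isomorphism classes of $\mathcal{F}$-semicharacteristic bisets, so this monoid is free. Moreover, an $\mathcal{F}$-semicharacteristic biset $$\Omega=\coprod_{(P)_{\mathcal{F}}\in Cl(\mathcal{F})}c_P\cdot\Omega_P\qquad(c_P\in\mathbb{Z}_{\ge 0})$$ is $\mathcal{F}$-characteristic if and only if $p\nmid c_S$.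
   Context: Fusion systems and saturation are in the usual sense (Puig; Broto-Levi-Oliver). $\mathcal{F}(P,Q)$ denotes the set of $\mathcal{F}$-morphisms $P\to Q$ for $P,Q\le S$; $(P)_{\mathcal{F}}$ is the set of subgroups of $S$ that are $\mathcal{F}$-isomorphic to $P$, and $Cl(\mathcal{F})$ is the set of all such classes. $P$ is fully $\mathcal{F}$-normalized if $|N_S(P)|\ge|N_S(Q)|$ for all $Q\in(P)_{\mathcal{F}}$. $\iota_P^S\colon P\to S$ is the inclusion. All bisets are finite. An $(S,S)$-biset is a finite set $\Omega$ with a free left $S$-action and a free right $S$-action that commute; equivalently a left $(S\times S)$-set via $(b,a)\cdot\omega=b\cdot\omega\cdot a^{-1}$ on which $S\times 1$ and $1\times S$ act freely. For $P\le S$ and an injective homomorphism $\varphi\colon P\to S$, write $(P,\varphi)=\{(\varphi(a),a)\mid a\in P\}\le S\times S$, and let $[P,\varphi]$ be the transitive biset $S\times_{(P,\varphi)}S\cong(S\times S)/(P,\varphi)$. Every point-stabilizer in an $(S,S)$-biset has the form $(P,\varphi)$. $\Omega^{(P,\varphi)}$ denotes the set of points fixed by $(P,\varphi)$. $\Omega$ is $\mathcal{F}$-generated if every point-stabilizer is of the form $(P,\varphi)$ with $\varphi\in\mathcal{F}(P,S)$. $\Omega$ is $\mathcal{F}$-stable if for every $P\le S$, injective homomorphism $\varphi\colon P\to S$, and $\mathcal{F}$-isomorphisms $\eta_1\colon Q\to P$ and $\eta_2\colon\varphi(P)\to R$, one has $|\Omega^{(P,\varphi)}|=|\Omega^{(Q,\eta_2\varphi\eta_1)}|$.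 $\Omega$ is $\mathcal{F}$-semicharacteristic if it is $\mathcal{F}$-generated and $\mathcal{F}$-stable, and $\mathcal{F}$-characteristic if in addition $|\Omega|/|S|\not\equiv 0\pmod p$. *)

(* Defs.v *)
From HB Require Import structures.
From mathcomp Require Import all_boot all_fingroup all_solvable.
From mathcomp Require Import boolp.

Set Implicit Arguments.
Unset Strict Implicit.
Unset Printing Implicit Defensive.

Import GroupScope.

(* The finite group S is the whole type gT, so the subgroups of S are the
   P : {group gT}, N_S(P) is 'N(P), and S itself is [set: gT]. *)

Section FusionSystems.

Variable gT : finGroupType.
Implicit Types (P Q R : {group gT}) (f g : gT -> gT).

(* A homomorphism P -> Q is represented by a function gT -> gT of which only
   the values on P matter; see fhom_eq. *)
Definition injhom P f : Prop := morphic P f /\ {in P &, injective f}.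

Definition iso_in (hom : {group gT} -> {group gT} -> pred (gT -> gT)) P Q f :=
  hom P Q f &&
  [exists g : {ffun gT -> gT},
     [&& hom Q P g, [forall x in P, g (f x) == x]
       & [forall y in Q, f (g y) == y]]].

(* Identities and inclusions are instances of fhom_conj, with s = 1. *)
Record fusion_system := FusionSystem {
  fhom : {group gT} -> {group gT} -> pred (gT -> gT);
  fhom_eq : forall P Q f g, {in P, f =1 g} -> fhom P Q f = fhom P Q g;
  fhom_inj : forall P Q f, fhom P Q f -> injhom P f /\ f @: P \subset Q;
  fhom_conj : forall P Q (s : gT), P :^ s \subset Q -> fhom P Q (conjg^~ s);
  fhom_comp : forall P Q R f g,
    fhom P Q f -> fhom Q R g -> fhom P R (g \o f);
  fhom_factor : forall P Q f,
    fhom P Q f -> exists2 R : {group gT}, R \subset Q & iso_in fhom P R f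
}.

Variable F : fusion_system.

Definition fiso P Q f := iso_in (fhom F) P Q f.

Definition fclass P : {set {group gT}} :=
  [set Q | [exists f : {ffun gT -> gT}, fiso P Q f]].

Definition fclasses :=
  {C : {set {group gT}} | C \in [set fclass P | P : {group gT}]}.
HB.instance Definition _ := Finite.on fclasses.

Definition fclass_of P : fclasses :=
  exist _ (fclass P) (imset_f fclass (isT : P \in {: {group gT}})).

Definition fully_normalized P :=
  forall Q, Q \in fclass P -> #|'N(Q)| <= #|'N(P)|.

Definition fully_centralized P :=
  forall Q, Q \in fclass P -> #|'C(Q)| <= #|'C(P)|.

Definition AutF P : {set {perm gT}} := [set a in Aut P | fhom F P P a].

Lemma AutF_group_set P : group_set (AutF P).
Proof.
apply/group_setP; split=> [|a b].
  rewrite inE group1 /=.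
  have e : {in P, (1 : {perm gT}) =1 conjg^~ 1} by move=> x _; rewrite perm1 conjg1.
  by rewrite (fhom_eq F P e) fhom_conj // conjsg1.
case/setIdP=> aA aF /setIdP[bA bF]; rewrite inE groupM //=.
have e : {in P, (a * b : {perm gT}) =1 b \o a} by move=> x _; rewrite permM.
by rewrite (fhom_eq F P e); apply: fhom_comp aF bF.
Qed.
Canonical AutF_group P := group (AutF_group_set P).

Definition AutS P : {set {perm gT}} := conj_aut P @* 'N(P).

(* N_f, the g in N_S(P) such that f c_g f^-1 is in Aut_S(f(P)). *)
Definition Nphi P f : {set gT} :=
  [set g in 'N(P) |
     [exists h in 'N(f @: P), [forall x in P, f (x ^ g) == f x ^ h]]].

Lemma Nphi_group_set P f : group_set (Nphi P f).
Proof.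
apply/group_setP; split=> [|g1 g2].
  rewrite inE group1 /=; apply/existsP; exists 1; rewrite group1 /=.
  by apply/forall_inP => x _; rewrite !conjg1.
case/setIdP=> n1 /exists_inP[h1 nh1 /forall_inP e1].
case/setIdP=> n2 /exists_inP[h2 nh2 /forall_inP e2].
rewrite inE groupM //=; apply/exists_inP; exists (h1 * h2); first by rewrite groupM.
apply/forall_inP => x xP; rewrite !conjgM -(eqP (e1 x xP)).
by apply: e2; rewrite memJ_norm.
Qed.
Canonical Nphi_group P f := group (Nphi_group_set P f).

(* Saturation in the sense of Broto, Levi and Oliver. *)
Definition saturated (p : nat) : Prop :=
  (forall P, fully_normalized P ->
     fully_centralized P /\ p.-Sylow(AutF P) (AutS P)) /\
  (forall P Q f, fhom F P [set: gT] f -> f @: P = Q -> fully_centralized Q ->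
     exists2 g, fhom F (Nphi_group P f) [set: gT] g & {in P, g =1 f}).

End FusionSystems.

HB.mixin Record isBiset (gT : finGroupType) T of Finite T := {
  bl : gT -> T -> T;
  br : T -> gT -> T;
  bl1 : forall w, bl 1 w = w;
  blM : forall b b' w, bl (b * b') w = bl b (bl b' w);
  br1 : forall w, br w 1 = w;
  brM : forall w a a', br w (a * a') = br (br w a) a';
  blr : forall b w a, bl b (br w a) = br (bl b w) a;
  bl_free : forall b w, bl b w = w -> b = 1;
  br_free : forall w a, br w a = w -> a = 1
}.

#[short(type="bisetType")]
HB.structure Definition Biset (gT : finGroupType) :=
  {T of Finite T & isBiset gT T}.

Section BisetTheory.

Variable gT : finGroupType.
Implicit Types (P : {group gT}) (f : gT -> gT) (A B : bisetType gT).

(* Actions of the library are on the right, so (b, a) acts as the inverse of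
   (b, a).w = b w a^-1; stabilizers and fixed points are the same. *)
Definition biset_mul A (w : A) (x : gT * gT) : A := br (bl x.1^-1 w) x.2.

Lemma biset_mul1 A (w : A) : biset_mul w 1 = w.
Proof. by rewrite /biset_mul /= invg1 bl1 br1. Qed.

Lemma biset_mulM A (w : A) : act_morph (@biset_mul A) w.
Proof.
by move=> [b a] [b' a']; rewrite /biset_mul /= invMg blM brM blr.
Qed.

Canonical biset_act A : {action gT * gT &-> A} :=
  TotalAction (@biset_mul1 A) (@biset_mulM A).

(* The subgroup (P, f) of S x S. *)
Definition tdiag P f : {set gT * gT} := [set (f a, a) | a in P].

Definition bhom A B (h : A -> B) : Prop :=
  (forall b w, h (bl b w) = bl b (h w)) /\
  (forall w a, h (br w a) = br (h w) a).

Definition biso A B : Prop := exists2 h : A -> B, bhom h & bijective h.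

Definition bsub A B : Prop := exists2 h : A -> B, bhom h & injective h.

Definition contains_orbit A B : Prop :=
  exists (w : B) (h : A -> B),
    [/\ bhom h, injective h & codom h =i orbit (biset_act B) [set: gT * gT] w].

End BisetTheory.

(* [P, f], as the set of left cosets of (P, f) in S x S. *)
Section TransitiveBiset.

Variables (gT : finGroupType) (P : {group gT}) (f : gT -> gT).
Hypothesis injf : injhom P f.

Lemma injhomM : {in P &, {morph f : x y / x * y}}.
Proof. by apply/morphicP; case: injf. Qed.

Lemma injhom1 : f 1 = 1.
Proof. by apply: (mulgI (f 1)); rewrite -injhomM ?group1 // !mulg1. Qed.

Lemma tdiag_group_set : group_set (tdiag P f).
Proof.
apply/group_setP; split=> [|x y].
  by apply/imsetP; exists 1; rewrite ?injhom1.
case/imsetP=> a aP -> /imsetP[b bP ->].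
by apply/imsetP; exists (a * b); rewrite ?groupM // injhomM.
Qed.

Definition tbiset & injhom P f :=
  {X : {set gT * gT} | X \in lcosets (tdiag P f) [set: gT * gT]}.
Local Notation T := (tbiset injf).

HB.instance Definition _ := Finite.on T.

Lemma tmul_subproof (x : gT * gT) (X : T) :
  x *: val X \in lcosets (tdiag P f) [set: gT * gT].
Proof.
case: X => X /= /lcosetsP[y _ ->]; apply/lcosetsP; exists (x * y) => //.
by rewrite lcosetM.
Qed.

Definition tmul x (X : T) : T := Sub (x *: val X) (tmul_subproof x X).

Lemma tmul_fix x X :
  tmul x X = X -> exists y, x ^ y \in tdiag P f.
Proof.
move/(congr1 val); case: X => X /= /lcosetsP[y _ ->] e; exists y.
have : x * y \in y *: tdiag P f.
  by rewrite -e -lcosetM (lcoset_refl (group tdiag_group_set)).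
by rewrite mem_lcoset.
Qed.

Fact tmul1 X : tmul 1 X = X.
Proof. by apply: val_inj; rewrite /= lcoset1. Qed.

Fact tmulM x y X : tmul (x * y) X = tmul x (tmul y X).
Proof. by apply: val_inj; rewrite /= lcosetM. Qed.

Let tl b X := tmul (b, 1) X.
Let tr X a := tmul (1, a^-1) X.

Fact tl1 X : tl 1 X = X. Proof. exact: tmul1. Qed.
Fact tlM b b' X : tl (b * b') X = tl b (tl b' X).
Proof. by rewrite /tl -tmulM; congr tmul; congr (_, _); rewrite mulg1. Qed.
Fact tr1 X : tr X 1 = X.
Proof. by rewrite /tr invg1; apply: tmul1. Qed.
Fact trM X a a' : tr X (a * a') = tr (tr X a) a'.
Proof. by rewrite /tr -tmulM invMg; congr tmul; congr (_, _); rewrite mulg1. Qed.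
Fact tlr b X a : tl b (tr X a) = tr (tl b X) a.
Proof.
by rewrite /tl /tr -!tmulM; congr tmul; congr (_, _); rewrite !(mulg1, mul1g).
Qed.
Fact tl_free b X : tl b X = X -> b = 1.
Proof.
case/tmul_fix=> -[y1 y2] /imsetP[a aP [e1 e2]].
have a1 : a = 1 by rewrite -e2; apply: conj1g.
have /eqP : b ^ y1 = 1 by rewrite /conjg e1 a1 injhom1.
by rewrite conjg_eq1 => /eqP.
Qed.
Fact tr_free X a : tr X a = X -> a = 1.
Proof.
case/tmul_fix=> -[y1 y2] /imsetP[c cP [e1 e2]].
have f1 : f c = 1 by rewrite -e1; apply: conj1g.
have c1 : c = 1 by case: injf => _ /(_ c 1 cP (group1 P)); apply; rewrite injhom1.
have /eqP : a^-1 ^ y2 = 1 by rewrite /conjg e2 c1.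
by rewrite conjg_eq1 invg_eq1 => /eqP.
Qed.

HB.instance Definition _ := isBiset.Build gT T
  tl1 tlM tr1 trM tlr tl_free tr_free.

End TransitiveBiset.

Lemma injhom_incl (gT : finGroupType) (P : {group gT}) : injhom P id.
Proof. by split=> //; apply/morphicP. Qed.

(* [P, iota_P^S]. *)
Definition incl_biset (gT : finGroupType) (P : {group gT}) : bisetType gT :=
  tbiset (injhom_incl P).

Section DisjointUnion.

Variable gT : finGroupType.

Fact void_free (P : Prop) (w : void) : P. Proof. by case: w. Qed.

HB.instance Definition _ := isBiset.Build gT void
  (bl := fun _ w => w) (br := fun w _ => w)
  (fun w => void_free _ w) (fun _ _ w => void_free _ w)
  (fun w => void_free _ w) (fun w _ _ => void_free _ w)
  (fun _ w _ => void_free _ w)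
  (fun _ w _ => void_free _ w) (fun w _ _ => void_free _ w).

Variables A B : bisetType gT.

Definition sum_bl (b : gT) (w : A + B) : A + B :=
  match w with inl u => inl (bl b u) | inr v => inr (bl b v) end.
Definition sum_br (w : A + B) (a : gT) : A + B :=
  match w with inl u => inl (br u a) | inr v => inr (br v a) end.

Fact sum_bl1 w : sum_bl 1 w = w.
Proof. by case: w => w /=; rewrite bl1. Qed.
Fact sum_blM b b' w : sum_bl (b * b') w = sum_bl b (sum_bl b' w).
Proof. by case: w => w /=; rewrite blM. Qed.
Fact sum_br1 w : sum_br w 1 = w.
Proof. by case: w => w /=; rewrite br1. Qed.
Fact sum_brM w a a' : sum_br w (a * a') = sum_br (sum_br w a) a'.
Proof. by case: w => w /=; rewrite brM. Qed.
Fact sum_blr b w a : sum_bl b (sum_br w a) = sum_br (sum_bl b w) a.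
Proof. by case: w => w /=; rewrite blr. Qed.
Fact sum_bl_free b w : sum_bl b w = w -> b = 1.
Proof. by case: w => w /= [] /bl_free. Qed.
Fact sum_br_free w a : sum_br w a = w -> a = 1.
Proof. by case: w => w /= [] /br_free. Qed.

HB.instance Definition _ := isBiset.Build gT (A + B)%type
  sum_bl1 sum_blM sum_br1 sum_brM sum_blr sum_bl_free sum_br_free.

Lemma sum_stab_l (w : A) :
  'C[inl w : (A + B)%type | biset_act _] = 'C[w | biset_act A].
Proof.
apply/setP=> x; rewrite !inE /= !sub1set !inE /=.
by apply/eqP/eqP => [[e]|e]; [exact: e|exact: (congr1 inl e)].
Qed.

Lemma sum_stab_r (w : B) :
  'C[inr w : (A + B)%type | biset_act _] = 'C[w | biset_act B].
Proof.
apply/setP=> x; rewrite !inE /= !sub1set !inE /=.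
by apply/eqP/eqP => [[e]|e]; [exact: e|exact: (congr1 inr e)].
Qed.

Lemma card_afix_sum (D : {set gT * gT}) :
  #|'Fix_(biset_act (A + B)%type)(D)| =
  #|'Fix_(biset_act A)(D)| + #|'Fix_(biset_act B)(D)|.
Proof.
rewrite -!sum1_card big_sumType /=.
by congr (_ + _)%N; apply: eq_bigl => w; rewrite !inE; congr (_ \subset _);
  apply/setP=> x; rewrite !inE.
Qed.

End DisjointUnion.

Section BisetIsomorphism.

Variable gT : finGroupType.
Implicit Types A B C D : bisetType gT.

Lemma biso_refl A : biso A A.
Proof. by exists id => //; exists id. Qed.

Lemma biso_sym A B : biso A B -> biso B A.
Proof.
case=> h [hl hr] [k hK kK]; exists k; last by exists h.
split=> [b w|w a]; first by rewrite -{1}[w]kK -hl hK.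
by rewrite -{1}[w]kK -hr hK.
Qed.

Lemma biso_trans A B C : biso A B -> biso B C -> biso A C.
Proof.
case=> h [hl hr] hb [k [kl kr] kb]; exists (k \o h); last exact: bij_comp.
by split=> *; rewrite /= ?hl ?hr ?kl ?kr.
Qed.

Lemma biso_sum A B C D :
  biso A B -> biso C D -> biso (A + C)%type (B + D)%type.
Proof.
case=> h [hl hr] [h' hK h'K] [k [kl kr] [k' kK k'K]].
exists (fun w => match w with inl u => inl (h u) | inr v => inr (k v) end).
  split=> [b [] w|[] w a]; congr (_ _); [exact: hl | exact: kl | exact: hr | exact: kr].
exists (fun w => match w with inl u => inl (h' u) | inr v => inr (k' v) end);
  by case=> w; rewrite ?hK ?h'K ?kK ?k'K.
Qed.

Lemma biso_sumA A B C : biso (A + (B + C))%type (A + B + C)%type.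
Proof.
exists (fun w => match w with inl u => inl (inl u)
  | inr (inl v) => inl (inr v) | inr (inr t) => inr t end).
  by split=> [b [w|[w|w]]|[w|[w|w]] a].
by exists (fun w => match w with inl (inl u) => inl u
  | inl (inr v) => inr (inl v) | inr t => inr (inr t) end) => [[w|[w|w]]|[[w|w]|w]].
Qed.

Lemma biso_sumC A B : biso (A + B)%type (B + A)%type.
Proof.
exists (fun w => match w with inl u => inr u | inr v => inl v end).
  by split=> [b [w|w]|[w|w] a].
by exists (fun w => match w with inl u => inr u | inr v => inl v end) => [[w|w]|[w|w]].
Qed.

Lemma biso_sum0 A : biso (void + A)%type A.
Proof.
exists (fun w : void + A => match w with inl u => of_void A u | inr v => v end).
  by split=> [b [[]|w]|[[]|w] a].
by exists inr => // -[[]|w].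
Qed.

End BisetIsomorphism.

Section Semicharacteristic.

Variables (gT : finGroupType) (F : fusion_system gT).

Definition F_generated (A : bisetType gT) : Prop :=
  forall w : A, exists (P : {group gT}) (f : gT -> gT),
    fhom F P [set: gT] f /\ 'C[w | biset_act A] = tdiag P f.

Definition F_stable (A : bisetType gT) : Prop :=
  forall (P P' Q R : {group gT}) (f e1 e2 : gT -> gT),
    injhom P f -> f @: P = P' -> fiso F Q P e1 -> fiso F P' R e2 ->
    #|'Fix_(biset_act A)(tdiag P f)|
      = #|'Fix_(biset_act A)(tdiag Q (e2 \o f \o e1))|.

Definition F_semicharacteristic A : Prop := F_generated A /\ F_stable A.

Definition F_characteristic (p : nat) (A : bisetType gT) : Prop :=
  F_semicharacteristic A /\ ~~ (p %| #|A| %/ #|[set: gT]|).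

Record semichar_biset := SemicharBiset {
  semichar_val :> bisetType gT;
  semicharP : F_semicharacteristic semichar_val
}.

Lemma semichar_void : F_semicharacteristic void.
Proof.
split=> [[]|P P' Q R f e1 e2 _ _ _ _]; by rewrite !eq_card0 // => -[].
Qed.

Lemma semichar_sum (A B : semichar_biset) : F_semicharacteristic (A + B)%type.
Proof.
case: A B => [A [gA sA]] [B [gB sB]]; split=> /=.
  case=> w; [have [P [f [Ff e]]] := gA w | have [P [f [Ff e]]] := gB w];
    exists P, f; split=> //; [exact: etrans (sum_stab_l _ _) e|
    exact: etrans (sum_stab_r _ _) e].
move=> P P' Q R f e1 e2 fi fP i1 i2.
by rewrite !card_afix_sum (sA _ _ _ _ _ _ _ fi fP i1 i2) (sB _ _ _ _ _ _ _ fi fP i1 i2).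
Qed.

Definition sc_empty := SemicharBiset semichar_void.
Definition sc_union A B := SemicharBiset (semichar_sum A B).

(* Isomorphism classes of F-semicharacteristic bisets. *)
Record scclass := ScClass {
  sc_mem : semichar_biset -> Prop;
  sc_memP : exists A : semichar_biset, sc_mem = (fun B => biso A B)
}.

Definition scclass_of (A : semichar_biset) : scclass :=
  @ScClass (fun B => biso A B) (ex_intro _ A erefl).

Definition sc_repr (X : scclass) : semichar_biset := projT1 (cid (sc_memP X)).

Lemma sc_reprK X : scclass_of (sc_repr X) = X.
Proof.
case: X => m mP; rewrite /sc_repr /=; case: cid => A /= e.
by subst m; congr ScClass; apply: Prop_irrelevance.
Qed.

Lemma scclass_eq (A B : semichar_biset) :
  scclass_of A = scclass_of B <-> biso A B.
Proof.
split=> [[/(congr1 (fun m => m B)) ->]|iAB]; first exact: biso_refl.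
have e : (fun C : semichar_biset => biso A C) = (fun C => biso B C).
  apply/funext=> C; apply/propext; split; last exact: biso_trans.
  exact: biso_trans (biso_sym iAB).
rewrite /scclass_of; move: (ex_intro _ A _) (ex_intro _ B _); rewrite e => u v.
by congr ScClass; apply: Prop_irrelevance.
Qed.

Definition sc_zero := scclass_of sc_empty.
Definition sc_add (X Y : scclass) :=
  scclass_of (sc_union (sc_repr X) (sc_repr Y)).

Lemma sc_addE (A B : semichar_biset) :
  sc_add (scclass_of A) (scclass_of B) = scclass_of (sc_union A B).
Proof.
apply/scclass_eq/biso_sum; apply/scclass_eq; exact: sc_reprK.
Qed.

Fact sc_addA : associative sc_add.
Proof.
move=> X Y Z; rewrite -(sc_reprK X) -(sc_reprK Y) -(sc_reprK Z) !sc_addE.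
exact/scclass_eq/biso_sumA.
Qed.
Fact sc_addC : commutative sc_add.
Proof. by move=> X Y; apply/scclass_eq/biso_sumC. Qed.
Fact sc_add0 : left_id sc_zero sc_add.
Proof. by move=> X; rewrite -(sc_reprK X) sc_addE; apply/scclass_eq/biso_sum0. Qed.

(* scclass is too large a type for nmodType, whose universe is below that of
   finType, hence the use of the monoid laws of bigop. *)
HB.instance Definition _ :=
  Monoid.isComLaw.Build scclass sc_zero sc_add sc_addA sc_addC sc_add0.

End Semicharacteristic.

Section CommutativeMonoids.

Variables (T : Type) (zero : T) (add : Monoid.com_law zero).

Definition lincomb (I : finType) (c : I -> nat) (b : I -> T) : T :=
  \big[add/zero]_(i : I) iter (c i) (add (b i)) zero.

Definition additive_basis (I : finType) (b : I -> T) : Prop :=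
  forall x : T, exists! c : {ffun I -> nat}, x = lincomb c b.

(* Isomorphic to the monoid of maps I -> nat, for some finite I. *)
Definition free_com_monoid : Prop :=
  exists (I : finType) (h : {ffun I -> nat} -> T),
    [/\ bijective h, h [ffun=> 0%N] = zero
      & forall c d : {ffun I -> nat},
          h [ffun i => (c i + d i)%N] = add (h c) (h d)].

End CommutativeMonoids.

(* Main.v *)
(* A subset of S x S of the form (P, f) with f in F is F x F-conjugate to
   (R, id), R the fully normalized representative of the class of P, and by
   saturation the conjugation extends to a monomorphism N(P, f) -> N(R, id).
   Hence, if fixed-point counts are F-stable strictly above (P, f), the defect
   |X^(R, id)| - |X^(P, f)| is a multiple of |N(P, f) : (P, f)|, and it is
   nonnegative when no point of X has stabilizer (P, f). Starting from
   [R, id] and going down by order of subgroups, the defects are repaired by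
   adding orbits of type (P, f); this gives Omega_R (Reeh's argument). The
   number of orbits of type (R, id) is additive, equals 1 on Omega_R and 0 on
   the other Omega_Q, and these numbers determine a semicharacteristic biset
   by downward induction on stabilizers, whence the basis. Finally, modulo p,
   |X| / |S| only counts the orbits whose stabilizer is (S, a) with a in
   Aut_F(S): there are c_S |Out_F(S)| of them, and p does not divide |Out_F(S)|. *)

Require Import Defs.
From mathcomp Require Import all_boot all_fingroup all_solvable.
From mathcomp Require Import boolp.

Set Implicit Arguments.
Unset Strict Implicit.
Unset Printing Implicit Defensive.

Import GroupScope.

(** * Points with a given stabilizer *)

Section PointsWithStabilizer.

Variables (aT : finGroupType) (D : {group aT}) (rT : finType).
Variable to : action D rT.
Implicit Types Q R : {group aT}.

(** These counts classify an action up to isomorphism, whereas stability controls fixed points; the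
    two are linked by a triangular system over the overgroups of [Q]. *)
Definition stabpts (Q : {set aT}) := [set x | 'C[x | to] == Q].

Lemma card_afix Q : Q \subset D ->
  #|'Fix_to(Q)| = (\sum_(R : {group aT} | Q \subset R) #|stabpts R|)%N.
Proof.
move=> sQD; rewrite -sum1_card.
rewrite (partition_big (fun x => [group of 'C[x | to]])
  (fun R : {group aT} => Q \subset R)) => [|x].
  apply: eq_bigr => R sQR; rewrite -sum1_card; apply: eq_bigl => x.
  rewrite -sub_astab1_in // inE -val_eqE /=.
  by apply: andb_idl => /eqP ->.
by rewrite -sub_astab1_in.
Qed.

Lemma card_afixD1 Q : Q \subset D -> #|'Fix_to(Q)| =
  (#|stabpts Q| + \sum_(R : {group aT} | Q \proper R) #|stabpts R|)%N.
Proof.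
move=> sQD; rewrite card_afix // (bigD1 Q) //=; congr (_ + _)%N.
by apply: eq_bigl => R; rewrite properEneq andbC eq_sym.
Qed.

Lemma stabpts_sub Q : ~~ (Q \subset D) -> #|stabpts Q| = 0.
Proof.
move=> nsQD; apply: eq_card0 => x; rewrite inE.
by apply: contraNF nsQD => /eqP <-; apply: subsetIl.
Qed.

(** [H] permutes the points with stabilizer [Q], and each of its orbits there is regular for
    [H / Q]. *)
Lemma dvdn_stabpts_in Q (H : {group aT}) :
  H \subset D -> Q \subset H -> H \subset 'N(Q) -> #|H : Q| %| #|stabpts Q|.
Proof.
move=> sHD sQH nQH; have actH : [acts H, on stabpts Q | to].
  rewrite /acts_on subsetI sHD; apply/subsetP=> x xH; rewrite inE.
  apply/subsetP=> y; rewrite !inE astab1_act_in ?(subsetP sHD) // => /eqP->.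
  by rewrite (normP (subsetP nQH x xH)).
rewrite -(acts_sum_card_orbit actH).
apply: dvdn_sum => _ /imsetP[y + ->]; rewrite inE => /eqP Cy.
by rewrite card_orbit_in // Cy (setIidPr sQH).
Qed.

End PointsWithStabilizer.

(* The points of Fix(Q) whose stabilizer is larger than Q are counted by the
   fixed points of the overgroups of Q, hence equally for both actions. *)
Lemma card_afix_stabpts (aT : finGroupType) (D Q : {group aT})
    (rT1 rT2 : finType) (to1 : action D rT1) (to2 : action D rT2) :
    Q \subset D ->
    (forall R : {group aT}, Q \proper R -> R \subset D ->
      #|'Fix_to1(R)| = #|'Fix_to2(R)|) ->
  (#|'Fix_to1(Q)| + #|stabpts to2 Q| = #|'Fix_to2(Q)| + #|stabpts to1 Q|)%N.
Proof.
move=> sQD eqfix.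
suff eqst (R : {group aT}) : Q \proper R -> #|stabpts to1 R| = #|stabpts to2 R|.
  rewrite !card_afixD1 // (eq_bigr _ (fun R sQR => eqst R sQR)).
  by rewrite addnAC [RHS]addnAC (addnC #|stabpts to1 Q|).
(* Descending induction on [|R|]: once all larger stabilizers are matched, equal fixed-point counts
   leave equal counts for [R] itself. *)
have [n] := ubnP (#|aT| - #|R|); elim: n R => // n IHn R; rewrite ltnS => leRn pQR.
have [sRD | nsRD] := boolP (R \subset D); last by rewrite !stabpts_sub.
have := eqfix R pQR sRD; rewrite !card_afixD1 //.
rewrite (eq_bigr (fun R' : {group aT} => #|stabpts to2 R'|)) => [/addIn //|].
move=> R' pRR'; apply: IHn; last exact: proper_trans pQR pRR'.
apply: leq_trans leRn; apply: ltn_sub2l; last exact: proper_card.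
by apply: leq_trans (proper_card pRR') _; apply: max_card.
Qed.

(** * Actions of the whole group: conjugation, pullback, transitivity *)

Section TotalActions.

Variable aT : finGroupType.
Implicit Types Q R : {group aT}.

Section OneAction.

Variables (rT : finType) (to : {action aT &-> rT}).

Lemma stabptsJ (A : {set aT}) x : #|stabpts to (A :^ x)| = #|stabpts to A|.
Proof.
rewrite -[RHS](card_imset _ (act_inj to x)); apply: eq_card => y.
apply/idP/imsetP=> [|[z + ->]]; rewrite !inE; last first.
  by move/eqP<-; rewrite -astab1_act.
move/eqP=> Cy; exists (to y x^-1); last by rewrite actKV.
by rewrite inE astab1_act Cy conjsgK.
Qed.

Lemma card_afixJ (A : {set aT}) x : #|'Fix_to(A :^ x)| = #|'Fix_to(A)|.
Proof.
rewrite -[RHS](card_imset _ (act_inj to x)); apply: eq_card => y.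
apply/idP/imsetP=> [|[z + ->]]; rewrite -!sub_astab1; last first.
  by rewrite astab1_act conjSg.
move=> sAy; exists (to y x^-1); last by rewrite actKV.
by rewrite -sub_astab1 astab1_act -sub_conjg.
Qed.

Lemma dvdn_stabpts Q : #|'N(Q) : Q| %| #|stabpts to Q|.
Proof. exact: dvdn_stabpts_in (subsetT _) (normG Q) (subxx _). Qed.

Lemma sum_stabpts : (\sum_(Q : {group aT}) #|stabpts to Q| = #|rT|)%N.
Proof.
have := card_afix to (sub1G [group of setT]).
rewrite afix1 cardsT => ->; apply: eq_bigl => Q.
by rewrite sub1G.
Qed.

Section Pullback.

Variables (D : {group aT}) (f : {morphism D >-> aT}).

Definition pull_act x a := to x (f a).

Lemma pull_is_action : is_action D pull_act.
Proof.
split=> [a x y /act_inj // | x a b aD bD].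
by rewrite /pull_act morphM // actM.
Qed.

Canonical pull_action := Action pull_is_action.

Lemma pull_astab1 x : 'C[x | pull_action] = f @*^-1 'C[x | to].
Proof.
by apply/setP=> a; rewrite !inE !sub1set !inE; case: (a \in D).
Qed.

Lemma pull_afix (A : {set aT}) : A \subset D -> 'Fix_pull_action(A) = 'Fix_to(f @* A).
Proof.
move=> sAD; apply/setP=> x; apply/afixP/afixP=> [fx _ /morphimP[a _ aA ->] | fx a aA].
  exact: fx.
by apply: fx; rewrite mem_morphim ?(subsetP sAD).
Qed.

End Pullback.

(* N(Q) acts on Fix(Q) and, through f, on Fix(f(Q)); k is the number of points
   of the second set in free N(Q)/Q-orbits. *)
Lemma afix_transfer (p : nat) Q (f : {morphism 'N(Q) >-> aT}) :
    p.-group [set: aT] -> 'injm f ->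
    (forall R : {group aT}, Q \proper R -> R \subset 'N(Q) ->
      #|'Fix_to(R)| = #|'Fix_to(f @* R)|) ->
  exists k, [/\ (#|'Fix_to(Q)| + k = #|'Fix_to(f @* Q)| + #|stabpts to Q|)%N,
    #|'N(Q) : Q| %| k & #|stabpts to (f @* Q)| <= k].
Proof.
move=> pT injf eqfix; have nQ := normG Q; pose N := [group of 'N(Q)].
exists #|stabpts (pull_action f) Q|; split.
(* Compares two actions of [N(Q)]: the given one, pulled back along the identity, and its pullback
   along [f]. *)
- have := @card_afix_stabpts _ N Q _ _ (pull_action (idm_morphism N)) (pull_action f) nQ.
  rewrite !pull_afix // morphim_idm // => ->; last first.
    by move=> R pQR sRN; rewrite !pull_afix // morphim_idm // eqfix.
  (* A point whose stabilizer meets [N(Q)] in [Q] has stabilizer [Q], because in a p-group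
     normalizers grow. *)
  congr (_ + _)%N; apply: eq_card => x; rewrite !inE pull_astab1 morphpre_idm.
  apply/eqP/eqP=> [CxN | ->]; last exact/setIidPr.
  apply: (nilpotent_sub_norm (G := astab_group to [set x])) => /=.
  - exact: (@pgroup_nil _ p (astab_group to [set x]) (pgroupS (subsetT _) pT)).
  - by rewrite -CxN subsetIr.
  by rewrite setIC CxN.
- exact: dvdn_stabpts_in.
apply/subset_leq_card/subsetP=> x; rewrite !inE pull_astab1 => /eqP->.
by rewrite morphimK ?(trivgP injf) ?mul1g.
Qed.

Lemma transitive_stabpts_conj w (A : {set aT}) :
    (forall y, exists x, y = to w x) -> 0 < #|stabpts to A| ->
  exists x, A = 'C[w | to] :^ x.
Proof.
move=> trans /card_gt0P[y]; rewrite inE; have [x ->] := trans y.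
by rewrite astab1_act => /eqP <-; exists x.
Qed.

Lemma transitive_stabpts w : (forall y, exists x, y = to w x) ->
  #|stabpts to 'C[w | to]| = #|'N('C[w | to]) : 'C[w | to]|.
Proof.
move=> trans; set C := 'C[w | to].
have -> : stabpts to C = orbit to 'N(C) w.
  apply/setP=> y; have [x ->] := trans y; rewrite inE astab1_act -/C.
  apply/eqP/imsetP=> [/normP nx | [z /normP nz e]]; first by exists x.
  by rewrite -(astab1_act to w x) e astab1_act.
by rewrite (card_orbit _ [group of 'N(C)]) /= (setIidPr (normG _)).
Qed.

End OneAction.

(** * Comparing actions by their stabilizer counts *)

Definition equivariant (rT1 rT2 : finType) (to1 : {action aT &-> rT1})
  (to2 : {action aT &-> rT2}) (h : rT1 -> rT2) := forall x a, h (to1 x a) = to2 (h x) a.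

(** Built greedily: an embedding of an invariant set [U] is extended to the orbit of a point [w]
    outside [U], using a point of the target with the same stabilizer that is not yet in the
    image. *)
Lemma stabpts_embedding (rT1 rT2 : finType) (to1 : {action aT &-> rT1})
    (to2 : {action aT &-> rT2}) :
    (forall Q, #|stabpts to1 Q| <= #|stabpts to2 Q|) ->
  exists2 h : rT1 -> rT2, equivariant to1 to2 h & injective h.
Proof.
move=> le12.
case: (pickP rT1) => [x0 _|rT10]; last first.
  have h (x : rT1) : rT2 by have := rT10 x.
  by exists h => x; have := rT10 x.
have [y0 _] : exists y0 : rT2, true.
  have : 0 < #|stabpts to2 'C[x0 | to1]|.
    by apply: leq_trans (le12 (astab_group to1 [set x0])); apply/card_gt0P; exists x0; rewrite inE.
  by case/card_gt0P=> y; exists y.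
suff ext n : exists (U : {set rT1}) (h : rT1 -> rT2),
    [/\ minn n #|rT1| <= #|U|, [acts [set: aT], on U | to1],
        {in U, forall x a, h (to1 x a) = to2 (h x) a} & {in U &, injective h}].
  have [U [h []]] := ext #|rT1|; rewrite minnn -cardsT => leU _ hE hI.
  have {leU} UT : U = setT by apply/eqP; rewrite eqEcard subsetT.
  by exists h; rewrite UT in hE hI; [move=> x a; apply: hE | move=> x y; apply: hI].
elim: n => [|n [U [h [leU actU hE hI]]]].
  exists set0, (fun=> y0); rewrite min0n; split=> //; last by move=> x; rewrite inE.
    by apply/actsP=> a _ x; rewrite !inE.
  by move=> x; rewrite inE.
have [UT | /subsetPn[w _ wU]] := boolP (setT \subset U).
  exists U, h; split=> //; apply: leq_trans (geq_minr _ _) _.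
  by rewrite -cardsT subset_leq_card.
have UE a x : (to1 x a \in U) = (x \in U) by apply: (actsP actU).
(* If all points with this stabilizer were in the image, they would come from such points of [U];
   these are too few since [w] is missing. *)
have [v vw vU] : exists2 v, v \in stabpts to2 'C[w | to1] & v \notin h @: U.
  apply/subsetPn; apply: contraL (le12 (astab_group to1 [set w])) => /= sU; rewrite -ltnNge.
  have pw : (U :&: stabpts to1 'C[w | to1]) \proper stabpts to1 'C[w | to1].
    by rewrite properEneq subsetIr andbT; apply/eqP=> /setP/(_ w); rewrite !inE eqxx (negPf wU).
  apply: leq_trans (proper_card pw); rewrite ltnS.
  rewrite -(card_in_imset (f := h)) => [|x y]; last first.
    by case/setIP=> xU _ /setIP[yU _]; apply: hI.
  apply/subset_leq_card/subsetP=> y yw; have /imsetP[x xU def_y] := subsetP sU y yw.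
  apply/imsetP; exists x => //; rewrite !inE xU /=.
  move: yw; rewrite inE def_y => /eqP <-; apply/eqP/setP=> a.
  apply/astab1P/astab1P=> [e|]; first by rewrite -hE // e.
  by rewrite -hE //; apply: hI; rewrite ?UE.
have stE a b : (to1 w a == to1 w b) = (to2 v a == to2 v b).
  move: vw; rewrite inE => /eqP vw; rewrite !(can2_eq (actK _ _) (actKV _ _)) -!actM.
  apply/eqP/eqP=> [e|e].
    by have /astab1P : b * a^-1 \in 'C[v | to2] by rewrite vw; apply/astab1P.
  by have /astab1P : b * a^-1 \in 'C[w | to1] by rewrite -vw; apply/astab1P.
(* On the new orbit [k] sends the translate of [w] by [a] to that of [v]; by [stE] the choice of [a]
   does not matter. *)
pose k x := if x \in U then h x else
  if [pick a | to1 w a == x] is Some a then to2 v a else h x.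
have kU x : x \in U -> k x = h x by rewrite /k => ->.
have kw a : k (to1 w a) = to2 v a.
  rewrite /k UE (negPf wU); case: pickP => [b|/(_ a)]; rewrite ?eqxx //.
  by rewrite stE => /eqP.
have hv x a : x \in U -> h x != to2 v a.
  move=> xU; apply: contra vU => /eqP e; apply/imsetP; exists (to1 x a^-1); rewrite ?UE //.
  by rewrite hE // e actK.
exists (U :|: orbit to1 setT w), k; split.
- rewrite geq_min; move: leU; rewrite geq_min => /orP[leU | ?]; last first.
    by rewrite orbC (leq_trans _ (subset_leq_card (subsetUl _ _))).
  rewrite (leq_trans _ (proper_card (_ : U \proper _))) //.
  rewrite properEneq subsetUl andbT; apply: contraNneq wU => ->.
  by rewrite inE orbit_refl orbT.
- by apply: actsU => //; apply: acts_orbit.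
- move=> x; rewrite inE => /orP[xU a | /imsetP[b _ ->] a]; first by rewrite !kU ?UE ?hE.
  by rewrite -actM !kw actM.
move=> x y; rewrite !inE => /orP[xU | /imsetP[a _ ->]] /orP[yU | /imsetP[b _ ->]].
- by rewrite !kU //; apply: hI.
- by rewrite kU // kw => /eqP; rewrite (negPf (hv _ _ _)).
- by rewrite kw kU // => /esym/eqP; rewrite (negPf (hv _ _ _)).
by rewrite !kw => /eqP; rewrite -stE => /eqP.
Qed.

(** The counts sum to the size of the set, so the embedding is between sets of equal size. *)
Lemma stabpts_isomorphism (rT1 rT2 : finType) (to1 : {action aT &-> rT1})
    (to2 : {action aT &-> rT2}) :
    (forall Q, #|stabpts to1 Q| = #|stabpts to2 Q|) ->
  exists2 h : rT1 -> rT2, equivariant to1 to2 h & bijective h.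
Proof.
move=> eq12; have [Q|h hE hI] := @stabpts_embedding _ _ to1 to2; first by rewrite eq12.
exists h => //; apply: inj_card_bij => //.
by rewrite -(sum_stabpts to1) -(sum_stabpts to2) (eq_bigr _ (fun Q _ => eq12 Q)).
Qed.

Lemma equivariant_stabpts (rT1 rT2 : finType) (to1 : {action aT &-> rT1})
    (to2 : {action aT &-> rT2}) (h : rT1 -> rT2) Q :
  equivariant to1 to2 h -> injective h -> #|stabpts to1 Q| <= #|stabpts to2 Q|.
Proof.
move=> hE hI; rewrite -[leqLHS](card_imset _ hI); apply/subset_leq_card/subsetP=> _ /imsetP[x + ->].
rewrite !inE => /eqP <-; apply/eqP; apply/setP=> a.
apply/astab1P/astab1P; rewrite -hE; first exact: hI.
by move->.
Qed.

End TotalActions.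

(** * Bisets and their orbits *)

Section BisetOrbits.

Variable gT : finGroupType.
Implicit Types (A B : bisetType gT) (Q D : {group gT * gT}) (P : {group gT}).

Lemma equivariant_bhom A B (h : A -> B) :
  equivariant (biset_act A) (biset_act B) h <-> bhom h.
Proof.
split=> [hE | [hl hr] w [b a]]; last by rewrite /= /biset_mul /= hr hl.
split=> [b w | w a].
  by have := hE w (b^-1, 1); rewrite /= /biset_mul /= !br1 invgK.
by have := hE w (1, a); rewrite /= /biset_mul /= invg1 !bl1.
Qed.

Local Notation npts A Q := #|stabpts (biset_act A) Q|.

Lemma stabpts_biso A B : biso A B <-> forall Q, npts A Q = npts B Q.
Proof.
split=> [[h /equivariant_bhom hE hb] Q | /stabpts_isomorphism[h /equivariant_bhom hE hI]].
  apply/eqP; rewrite eqn_leq (equivariant_stabpts _ hE (bij_inj hb)) /=.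
  have [k hK kK] := hb.
  apply: (equivariant_stabpts (h := k)); last exact: can_inj kK.
  by move=> y a; rewrite -{1}[y]kK -hE hK.
by exists h.
Qed.

Lemma stabpts_sum A B (D : {set gT * gT}) : npts (A + B)%type D = (npts A D + npts B D)%N.
Proof.
rewrite -!sum1_card big_sumType /=.
by congr (_ + _)%N; apply: eq_bigl => w; rewrite !inE (sum_stab_l, sum_stab_r).
Qed.

Lemma stabpts_void (D : {set gT * gT}) : npts void D = 0.
Proof. by apply: eq_card0 => -[]. Qed.

Section Transitive.

Variables (P : {group gT}) (f : gT -> gT) (injf : injhom P f).

Definition tdiag_group := group (tdiag_group_set injf).

Fact base_coset_subproof : tdiag P f \in lcosets (tdiag P f) [set: gT * gT].
Proof. by apply/lcosetsP; exists 1; rewrite ?inE ?lcoset1. Qed.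

Definition base_coset : tbiset injf := Sub (tdiag P f) base_coset_subproof.

Lemma biset_mul_tmul (w : tbiset injf) x : biset_act (tbiset injf) w x = tmul x^-1 w.
Proof.
case: x => b a; rewrite /= /biset_mul /= -[bl _ _]/(tmul (b^-1, 1) w).
rewrite -[br _ _]/(tmul (1, a^-1) (tmul (b^-1, 1) w)) -tmulM; congr tmul.
by congr (_, _); rewrite /= ?mulg1 ?mul1g.
Qed.

Lemma tbiset_trans (w : tbiset injf) :
  exists x, w = biset_act (tbiset injf) base_coset x.
Proof.
case/lcosetsP: (valP w) => x _ def_w; exists x^-1.
by apply: val_inj; rewrite biset_mul_tmul invgK.
Qed.

Lemma base_coset_stab : 'C[base_coset | biset_act (tbiset injf)] = tdiag P f.
Proof.
apply/setP=> x; apply/astab1P/idP; rewrite biset_mul_tmul.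
  move/(congr1 val) => /= e; rewrite -[x]invgK (groupV tdiag_group) /=.
  by rewrite -e -[X in X \in _]mulg1 mem_lcoset mulKg (group1 tdiag_group).
move=> xD; apply: val_inj => /=.
by apply: (lcoset_id (G := tdiag_group)); rewrite groupV.
Qed.

Lemma stabpts_tbiset D :
  npts (tbiset injf) D = (#|'N(D) : D| * [exists x, tdiag P f :^ x == D])%N.
Proof.
case: existsP => [[x /eqP <-] | nconj]; last first.
  rewrite muln0; apply: contra_not_eq nconj; rewrite -lt0n => /transitive_stabpts_conj.
  by case/(_ _ tbiset_trans)=> x; rewrite base_coset_stab => ->; exists x.
rewrite muln1 stabptsJ -base_coset_stab transitive_stabpts; last exact: tbiset_trans.
by rewrite normJ indexJg.
Qed.

End Transitive.

Lemma contains_orbit_stabpts P A :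
  contains_orbit (incl_biset P) A <-> 0 < npts A (tdiag P id).
Proof.
split=> [[_ [h [/equivariant_bhom hE hI _]]] | eA].
  apply: leq_trans (equivariant_stabpts (tdiag_group (injhom_incl P)) hE hI).
  apply/card_gt0P; exists (base_coset (injhom_incl P)).
  by rewrite inE base_coset_stab.
have [|h hE hI] := stabpts_embedding (to1 := biset_act (incl_biset P)) (to2 := biset_act A).
  move=> Q; rewrite stabpts_tbiset; case: existsP => [[x /eqP def_Q]|_]; last by rewrite muln0.
  (* A nonzero count at [Q] is a multiple of [|N(Q) : Q|], hence at least the count in the
     transitive biset. *)
  rewrite muln1; apply: dvdn_leq (dvdn_stabpts _ Q).
  by rewrite -def_Q stabptsJ.
exists (h (base_coset (injhom_incl P))), h; split=> //; first exact/equivariant_bhom.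
move=> w; apply/codomP/imsetP=> [[y ->] | [x _ ->]].
  by have [x ->] := tbiset_trans y; exists x; rewrite ?inE ?hE.
by exists (biset_act _ (base_coset (injhom_incl P)) x); rewrite hE.
Qed.

(** Here [m D] is the multiplicity of the orbit type of [D]; an orbit of that type has [|N(D) : D|]
    points with stabilizer [D]. Induction on the sum of [m]. *)
Lemma biset_with_orbits (m : {group gT * gT} -> nat) :
    (forall D D' x, D' = D :^ x :> {set _} -> m D' = m D) ->
    (forall D, 0 < m D -> exists P f, injhom P f /\ tdiag P f = D) ->
  exists A, forall D, npts A D = (m D * #|'N(D) : D|)%N.
Proof.
have [n] := ubnP (\sum_D m D); elim: n m => // n IHn m; rewrite ltnS => le_mn mJ mD.
have [D0 mD0 | m0] := pickP (fun D => 0 < m D); last first.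
  by exists void => D; rewrite stabpts_void; have /negbT := m0 D; rewrite -eqn0Ngt => /eqP->.
have [P [f [injf def_D0]]] := mD D0 mD0.
pose cj (D : {group gT * gT}) := [exists x, tdiag P f :^ x == D].
have cjm D : cj D -> m D = m D0.
  by case/existsP=> x; rewrite def_D0 => /eqP/esym/mJ.
(* Removing one orbit lowers [m] by one on the whole conjugacy class of [D0], of which [cj] is the
   indicator. *)
have [|D D' x def_D'|D|A eA] := IHn (fun D => m D - cj D)%N.
- apply: leq_trans le_mn; rewrite (bigD1 D0) // [ltnRHS](bigD1 D0) //= -addSn.
  apply: leq_add; last by apply: leq_sum => D _; apply: leq_subr.
  have -> : cj D0 by apply/existsP; exists 1; rewrite conjsg1 def_D0.
  by rewrite subn1 prednK.
- rewrite (mJ _ _ _ def_D'); congr (_ - nat_of_bool _)%N.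
  apply/existsP/existsP=> -[y /eqP e]; last by exists (y * x); rewrite conjsgM e def_D'.
  by exists (y * x^-1); rewrite conjsgM e def_D' conjsgK.
- by move=> mcD; apply: mD; apply: leq_trans mcD (leq_subr _ _).
exists (tbiset injf + A)%type => D; rewrite stabpts_sum stabpts_tbiset eA -/(cj D).
have : cj D <= m D by case cjD: (cj D) => //; rewrite (cjm D cjD).
by rewrite mulnC -mulnDl => /subnKC->.
Qed.

End BisetOrbits.

Lemma injhomJ (gT : finGroupType) (P : {group gT}) f :
  injhom P f -> {in P &, forall x y, f (x ^ y) = f x ^ f y}.
Proof. by move=> injf; apply: (morphJ (Morphism (injhomM injf))). Qed.

(** * Isomorphisms and conjugacy classes of a fusion system *)

Section FusionBasics.

Variables (gT : finGroupType) (F : fusion_system gT).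
Implicit Types (P Q R : {group gT}) (f g : gT -> gT).

Lemma fhom_injhom P Q f : fhom F P Q f -> injhom P f.
Proof. by case/fhom_inj. Qed.

Lemma fhom_sub P Q f : fhom F P Q f -> f @: P \subset Q.
Proof. by case/fhom_inj. Qed.

Lemma fhom_id P Q : P \subset Q -> fhom F P Q id.
Proof.
move=> sPQ; rewrite (fhom_eq F Q (g := conjg^~ 1)) => [|x _]; last by rewrite conjg1.
by rewrite fhom_conj // conjsg1.
Qed.

Lemma fhom_codom P Q R f : Q \subset R -> fhom F P Q f -> fhom F P R f.
Proof. by move=> sQR Ff; apply: (fhom_comp Ff (fhom_id sQR)). Qed.

Lemma fhom_res P Q R f : R \subset P -> fhom F P Q f -> fhom F R Q f.
Proof. by move=> sRP; apply: fhom_comp (fhom_id sRP). Qed.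

Lemma fisoP P Q f : fiso F P Q f <->
  exists g, [/\ fhom F P Q f, fhom F Q P g, {in P, cancel f g} & {in Q, cancel g f}].
Proof.
split=> [/andP[Ff /existsP[g /and3P[Fg /forall_inP fK /forall_inP gK]]] | [g [Ff Fg fK gK]]].
  by exists g; split=> // x xP; apply/eqP; auto.
apply/andP; split=> //; apply/existsP; exists (finfun g).
rewrite (fhom_eq F P (g := g)) => [|x _]; last by rewrite ffunE.
by apply/and3P; split=> //; apply/forall_inP=> x xP; rewrite ffunE ?fK ?gK.
Qed.

Lemma fiso_sym P Q f : fiso F P Q f ->
  exists g, [/\ fiso F Q P g, {in P, cancel f g} & {in Q, cancel g f}].
Proof.
by case/fisoP=> g [Ff Fg fK gK]; exists g; split=> //; apply/fisoP; exists f.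
Qed.

Lemma fiso_fhom P Q f : fiso F P Q f -> fhom F P Q f.
Proof. by case/andP. Qed.

Lemma fiso_im P Q f : fiso F P Q f -> f @: P = Q.
Proof.
case/fisoP=> g [Ff Fg fK gK]; apply/eqP; rewrite eqEsubset (fhom_sub Ff).
apply/subsetP=> y yQ; apply/imsetP; exists (g y); last by rewrite gK.
by rewrite (subsetP (fhom_sub Fg)) ?imset_f.
Qed.

Lemma fiso_trans P Q R f g : fiso F P Q f -> fiso F Q R g -> fiso F P R (g \o f).
Proof.
case/fisoP=> f' [Ff Ff' fK f'K] /fisoP[g' [Fg Fg' gK g'K]]; apply/fisoP; exists (f' \o g').
split; [exact: fhom_comp Ff Fg | exact: fhom_comp Fg' Ff' | |] => x xP /=.
  by rewrite gK ?fK // (subsetP (fhom_sub Ff)) ?imset_f.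
by rewrite f'K ?g'K // (subsetP (fhom_sub Fg')) ?imset_f.
Qed.

Lemma fhom_fiso P Q R f : fhom F P Q f -> f @: P = R -> fiso F P R f.
Proof.
move=> /fhom_factor[R' _ iR'] def_R; suff -> : R = R' by [].
by apply: val_inj; rewrite /= -def_R (fiso_im iR').
Qed.

Lemma fhom_im_group P Q f : fhom F P Q f ->
  exists2 R : {group gT}, R = f @: P :> {set gT} & fiso F P R f.
Proof. by case/fhom_factor=> R _ iR; exists R; rewrite ?(fiso_im iR). Qed.

Lemma fhom_im P Q R f : fhom F P Q f -> f @: P \subset R -> fhom F P R f.
Proof.
case/fhom_im_group=> I <- iI sIR; exact: fhom_codom sIR (fiso_fhom iI).
Qed.

Lemma fclassP P Q : reflect (exists f, fiso F P Q f) (Q \in fclass F P).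
Proof.
rewrite inE; apply: (iffP existsP) => [[f Ff] | [f /fisoP[g [Ff Fg fK gK]]]]; first by exists f.
have fE : {in P, finfun f =1 f} by move=> x _; rewrite ffunE.
exists (finfun f); apply/fisoP; exists g; split=> [|//|x xP|x xQ].
- by rewrite (fhom_eq F Q fE).
- by rewrite ffunE fK.
by rewrite ffunE gK.
Qed.

Lemma fclass_refl P : P \in fclass F P.
Proof.
by apply/fclassP; exists id; apply/fisoP; exists id; rewrite fhom_id.
Qed.

Lemma fclass_eq P Q : Q \in fclass F P -> fclass F Q = fclass F P.
Proof.
case/fclassP=> f iPQ; have [g [iQP _ _]] := fiso_sym iPQ.
apply/setP=> R; apply/fclassP/fclassP=> -[h iR].
  by exists (h \o f); apply: fiso_trans iPQ iR.
by exists (h \o g); apply: fiso_trans iQP iR.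
Qed.

Lemma fiso_class P Q f : fiso F P Q f -> fclass_of F Q = fclass_of F P.
Proof. by move=> iPQ; apply/val_inj/fclass_eq/fclassP; exists f. Qed.

Lemma fiso_card P Q f : fiso F P Q f -> #|Q| = #|P|.
Proof.
move=> iPQ; rewrite -(fiso_im iPQ) card_in_imset //.
by case: (fhom_injhom (fiso_fhom iPQ)).
Qed.

Lemma fclass_of_fiso P Q : fclass_of F P = fclass_of F Q -> exists f, fiso F P Q f.
Proof. by move/(congr1 val) => /= e; apply/fclassP; rewrite e fclass_refl. Qed.

Lemma fully_normalized_exists (C : fclasses F) :
  exists P, fully_normalized F P /\ fclass_of F P = C.
Proof.
have [P0 _ def_C] := imsetP (valP C).
have [P P_C maxP] := arg_maxnP (fun P => #|'N(P)|) (fclass_refl P0).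
exists P; split; last by apply: val_inj; rewrite def_C; apply: fclass_eq.
by move=> Q; rewrite (fclass_eq P_C) => /maxP.
Qed.

Definition rep (C : fclasses F) : {group gT} := projT1 (cid (fully_normalized_exists C)).

Lemma rep_fn C : fully_normalized F (rep C).
Proof. by rewrite /rep; case: cid => P []. Qed.

Lemma rep_class C : fclass_of F (rep C) = C.
Proof. by rewrite /rep; case: cid => P []. Qed.

(** * Extension of isomorphisms under saturation *)

Variable p : nat.
Hypotheses (pS : p.-group [set: gT]) (satF : saturated F p).

(** The map [f] extends [f0] only up to an automorphism [c] of [P]: by Sylow, [c] moves the copy of
    [Aut_S(Q)] transported by [f0] into [Aut_S(P)], so the extension domain of the composite is all
    of [N(Q)]. *)
Lemma fiso_extension P Q f0 : fully_normalized F P -> fiso F Q P f0 ->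
  exists2 f, fhom F [group of 'N(Q)] [set: gT] f & f @: Q = P.
Proof.
move=> fnP iQP; have [sat1 sat2] := satF; have [fcP sylP] := sat1 P fnP.
have [mf0 If0] := fhom_injhom (fiso_fhom iQP); have im0 := fiso_im iQP.
have [g0 [iPQ f0K g0K]] := fiso_sym iQP.
pose f := @Morphism _ _ Q f0 (@injhomM _ _ _ (fhom_injhom (fiso_fhom iQP))).
have injf : 'injm f by apply/injmP.
have imf : f @* Q = P by rewrite morphimEdom.
pose H := Aut_isom injf (subxx Q) @* AutS Q.
have HE s : s \in 'N(Q) ->
    {in Q, forall x, Aut_isom injf (subxx Q) (conj_aut Q s) (f0 x) = f0 (x ^ s)}.
  move=> nQg x xQ; have := Aut_isomE injf (subxx Q) (a := conj_aut Q s).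
  by move=> -> //; rewrite ?norm_conj_autE // (subsetP (Aut_conj_aut Q 'N(Q))) ?mem_morphim.
have sHA : H \subset AutF F P.
  apply/subsetP=> _ /morphimP[_ _ /morphimP[s _ nQg ->] ->]; rewrite inE.
  have := Aut_Aut_isom injf (subxx Q) (conj_aut Q s); rewrite imf => -> /=.
  have e : {in P, Aut_isom injf (subxx Q) (conj_aut Q s) =1 f0 \o (conjg^~ s \o g0)}.
    by move=> y; rewrite -im0 => /imsetP[x xQ ->]; rewrite HE //= f0K.
  rewrite (fhom_eq F P e); apply: fhom_comp (fiso_fhom iQP).
  by apply: fhom_comp (fiso_fhom iPQ) _; apply: fhom_conj; rewrite (normP nQg).
have pH : p.-group H by rewrite !morphim_pgroup // (pgroupS (subsetT _)).
have [c cA sHc] := Sylow_Jsub sylP sHA pH.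
have [autc Fc] := setIdP cA.
pose h := c \o f0.
have Fh : fhom F Q P h := fhom_comp (fiso_fhom iQP) Fc.
have imh : h @: Q = P by rewrite imset_comp im0 -[RHS](im_autm autc) morphimEdom.
have Fh' := fhom_codom (subsetT P) Fh.
have [f' Ff' f'E] := sat2 Q P h Fh' imh fcP; exists f'; last first.
  by rewrite -imh; apply: eq_in_imset.
apply: fhom_res Ff'; apply/subsetP=> s nQg; rewrite inE [_ \in _]nQg /=.
(* [n] induces on [P] the automorphism [h c_s h^-1]. *)
have /morphimP[n _ nPn e] : Aut_isom injf (subxx Q) (conj_aut Q s) ^ c \in AutS P.
  rewrite (subsetP sHc) // memJ_conjg !mem_morphim //.
  by rewrite (subsetP (Aut_conj_aut Q 'N(Q))) ?mem_morphim.
apply/existsP; exists n; rewrite imh nPn; apply/forall_inP=> x xQ.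
have f0P : f0 x \in P by rewrite -im0 imset_f.
have hP : h x \in P by rewrite -imh imset_f.
rewrite -[h x ^ n](norm_conj_autE nPn hP) -e /h /= conjgE !permM permK.
by rewrite HE.
Qed.

(* The normalizer of (Q, psi) projects to N(Q) and to the extension domain of
   alpha psi^-1, where alpha : Q -> P extends to N(Q). *)
Lemma tdiag_norm_extension P Q psi :
    fully_normalized F P -> fhom F Q [set: gT] psi -> P \in fclass F Q ->
  exists (NB : {group gT}) (al be : gT -> gT),
    [/\ fhom F [group of 'N(Q)] [set: gT] al, fhom F NB [set: gT] be, al @: Q = P,
        {in Q, be \o psi =1 al} & 'N(tdiag Q psi) \subset setX NB 'N(Q)].
Proof.
move=> fnP Fpsi /fclassP[f0 iQP].
have [al Fal imal] := fiso_extension fnP iQP.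
have FalQ : fhom F Q [set: gT] al by apply: fhom_res Fal; apply: normG.
have iQP' := fhom_fiso FalQ imal.
have [R def_R iQR] := fhom_im_group Fpsi.
have [g [iRQ psiK gK]] := fiso_sym iQR.
(* [b0] is [alpha psi^-1]; it extends to [N_b0] because [P] is fully centralized. *)
have iRP := fiso_trans iRQ iQP'; set b0 := al \o g in iRP.
have [fcP _] := satF.1 P fnP.
have Fb0 := fhom_codom (subsetT P) (fiso_fhom iRP).
have [be Fbe beE] := satF.2 R P b0 Fb0 (fiso_im iRP) fcP.
exists (Nphi_group R b0), al, be; split=> //.
  move=> x xQ /=; rewrite beE /b0 /= ?psiK //.
  by rewrite def_R imset_f.
apply/subsetP=> -[b a] /normP nab; rewrite inE /=.
have psiJ x : x \in Q -> (psi x ^ b, x ^ a) \in tdiag Q psi.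
  by move=> xQ; rewrite -nab -[(_, _)]/((psi x, x) ^ (b, a)) memJ_conjg; apply: imset_f.
have nQa : a \in 'N(Q).
  by rewrite inE; apply/subsetP=> _ /imsetP[x xQ ->]; have /imsetP[y yQ [_ ->]] := psiJ x xQ.
have psiJE x : x \in Q -> psi x ^ b = psi (x ^ a).
  by move=> xQ; have /imsetP[y yQ [-> ->]] := psiJ x xQ.
rewrite nQa andbT inE; apply/andP; split.
  rewrite inE def_R; apply/subsetP=> _ /imsetP[_ /imsetP[x xQ ->] ->].
  by rewrite psiJE // imset_f ?memJ_norm.
have alJ x : x \in Q -> al (x ^ a) = al x ^ al a.
  by move=> xQ; apply: (injhomJ (fhom_injhom Fal)) => //; apply: (subsetP (normG Q)).
have b0psi x : x \in Q -> b0 (psi x) = al x by move=> xQ; rewrite /b0 /= psiK.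
(* Conjugation by [b] on [psi(Q)] is [psi c_a psi^-1], so [b0] transports it to conjugation by
   [al a]. *)
apply/existsP; exists (al a); apply/andP; split.
  rewrite (fiso_im iRP) inE; apply/subsetP=> _ /imsetP[y + ->].
  rewrite -imal => /imsetP[x xQ ->].
  by rewrite -alJ // imset_f ?memJ_norm.
apply/forall_inP=> y; rewrite def_R => /imsetP[x xQ ->].
by rewrite psiJE // !b0psi ?memJ_norm // alJ.
Qed.

End FusionBasics.

(** * Twisted diagonals and stability *)

Section TwistedDiagonals.

Variables (gT : finGroupType) (F : fusion_system gT).
Implicit Types (P Q : {group gT}) (D E R : {group gT * gT}) (C : fclasses F).
Implicit Types (A B : bisetType gT) (f g : gT -> gT).

Local Notation npts A Q := #|stabpts (biset_act A) Q|.
Local Notation nfix A Q := #|'Fix_(biset_act A)(Q)|.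

Lemma tdiag_snd P f : snd @: tdiag P f = P.
Proof.
by rewrite -imset_comp; apply/setP=> x; apply/imsetP/idP=> [[y ? ->] | ?] //; exists x.
Qed.

Lemma mem_tdiag P f a b : ((b, a) \in tdiag P f) = (a \in P) && (b == f a).
Proof.
apply/imsetP/andP=> [[x xP [-> ->]] | [aP /eqP->]]; first by rewrite eqxx.
by exists a.
Qed.

Lemma tdiag_subP P Q f g :
  reflect (P \subset Q /\ {in P, f =1 g}) (tdiag P f \subset tdiag Q g).
Proof.
apply: (iffP subsetP) => [sPQ | [/subsetP sPQ efg] [b a]]; last first.
  by rewrite !mem_tdiag => /andP[aP /eqP->]; rewrite sPQ // efg ?eqxx.
have {}sPQ x : x \in P -> (f x, x) \in tdiag Q g by move=> xP; rewrite sPQ ?imset_f.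
by split=> [|x /sPQ]; first apply/subsetP=> x /sPQ; rewrite mem_tdiag => /andP[? /eqP].
Qed.

Lemma card_tdiag P f : #|tdiag P f| = #|P|.
Proof. by rewrite card_imset // => x y []. Qed.

(** The possible stabilizers in an F-generated biset, labelled by the class of their source. For
    fixed [C] they form one [F x F]-class, with [repd C] as base point. *)
Definition Fdiag C (D : {set gT * gT}) := exists P f,
  [/\ fhom F P [set: gT] f, tdiag P f = D & fclass_of F P = C].

Definition repd C := tdiag_group (injhom_incl (rep C)).

Lemma Fdiag_tdiag P f : fhom F P [set: gT] f -> Fdiag (fclass_of F P) (tdiag P f).
Proof. by exists P, f. Qed.

Lemma Fdiag_id P : Fdiag (fclass_of F P) (tdiag P id).
Proof. by apply/Fdiag_tdiag/fhom_id/subsetT. Qed.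

Lemma Fdiag_repd C : Fdiag C (repd C).
Proof. by have := Fdiag_id (rep C); rewrite rep_class. Qed.

Lemma Fdiag_inj C C' D : Fdiag C D -> Fdiag C' D -> C = C'.
Proof.
move=> [P [f [_ <- <-]]] [Q [g [_ e <-]]]; congr fclass_of; apply: val_inj.
by rewrite /= -(tdiag_snd P f) -e tdiag_snd.
Qed.

Lemma Fdiag_card C D : Fdiag C D -> #|D| = #|rep C|.
Proof.
move=> [P [f [_ <- <-]]]; rewrite card_tdiag.
have /fclass_of_fiso[g ig] := rep_class (fclass_of F P).
by rewrite (fiso_card ig).
Qed.

Lemma Fdiag_sub C D E : Fdiag C D -> E \subset D -> exists C', Fdiag C' E.
Proof.
move=> [P [f [Ff <- _]]] sED; pose Q := [group of snd_morphism _ _ @* E].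
have sQP : Q \subset P.
  by apply/subsetP=> _ /morphimP[[b a] _ /(subsetP sED) + ->]; rewrite mem_tdiag => /andP[].
exists (fclass_of F Q), Q, f; split=> //; first exact: fhom_res sQP Ff.
apply/setP=> -[b a]; rewrite mem_tdiag.
apply/andP/idP=> [[/morphimP[[b' a'] _ baE /= e] /eqP ->] | baE].
  by have := subsetP sED _ baE; rewrite mem_tdiag -e => /andP[_ /eqP<-]; rewrite e.
split; first by apply/morphimP; exists (b, a).
by have := subsetP sED _ baE; rewrite mem_tdiag => /andP[].
Qed.

Definition pairmap f g (x : gT * gT) := (f x.1, g x.2).

(** The image of [(P0, h)] under [f x g] is [(g(P0), f h g^-1)], and [g(P0)] is in the class of
    [P0]. *)
Lemma Fdiag_pairmap C (D : {set gT * gT}) P Q f g :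
    Fdiag C D -> D \subset setX P Q -> fhom F P [set: gT] f ->
  fhom F Q [set: gT] g -> Fdiag C (pairmap f g @: D).
Proof.
move=> [P0 [h [Fh <- <-]]] /subsetP sD Ff Fg.
have sP0Q : P0 \subset Q.
  by apply/subsetP=> x xP0; have := sD _ (imset_f (fun x => (h x, x)) xP0); rewrite inE => /andP[].
have shP : h @: P0 \subset P.
  apply/subsetP=> _ /imsetP[x xP0 ->].
  by have := sD _ (imset_f (fun x => (h x, x)) xP0); rewrite inE => /andP[].
have [R def_R iR] := fhom_im_group (fhom_res sP0Q Fg).
have [g' [iR' gK g'K]] := fiso_sym iR.
exists R, (f \o h \o g'); split; last by rewrite (fiso_class iR).
  apply: fhom_comp (fiso_fhom iR') _.
  by apply: fhom_comp (fhom_im Fh shP) Ff.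
rewrite /tdiag def_R -!imset_comp; apply: eq_in_imset => x xP0 /=.
by rewrite gK.
Qed.

Lemma Fdiag_conj C (D : {set gT * gT}) x : Fdiag C D -> Fdiag C (D :^ x).
Proof.
move=> FD; have Fc (s : gT) : fhom F [group of setT] [set: gT] (conjg^~ s).
  by apply: fhom_conj; apply: subsetT.
have := Fdiag_pairmap FD _ (Fc x.1) (Fc x.2).
by apply; apply/subsetP=> y _; rewrite !inE.
Qed.

Lemma F_generatedP A :
  F_generated F A <-> forall w : A, exists C, Fdiag C 'C[w | biset_act A].
Proof.
split=> gA w; first by have [P [f [Ff ->]]] := gA w; exists (fclass_of F P); apply: Fdiag_tdiag.
by have [C [P [f [Ff e _]]]] := gA w; exists P, f.
Qed.

Lemma F_generated_stabpts A :
  F_generated F A <-> forall D, 0 < npts A D -> exists C, Fdiag C D.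
Proof.
rewrite F_generatedP; split=> [gA D /card_gt0P[w] | gA w].
  by rewrite inE => /eqP <-.
by apply: (gA (astab_group (biset_act A) [set w])); apply/card_gt0P; exists w; rewrite inE.
Qed.

Lemma F_generated_tdiag A P f :
  F_generated F A -> 0 < nfix A (tdiag P f) -> fhom F P [set: gT] f.
Proof.
move=> gA /card_gt0P[w]; rewrite -sub_astab1.
have [Q [g [Fg ->]]] := gA w => /tdiag_subP[sPQ efg].
by rewrite (fhom_eq F _ efg) (fhom_res sPQ Fg).
Qed.

Lemma F_generated_Fdiag A D :
  F_generated F A -> 0 < nfix A D -> exists C, Fdiag C D.
Proof.
move=> /F_generatedP gA /card_gt0P[w]; rewrite -sub_astab1.
by have [C FC] := gA w; apply: (Fdiag_sub (D := astab_group _ [set w])) FC.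
Qed.

(** Stability measured against the base point and only from order [n] on, the form suited to
    descending induction. *)
Definition stable_above n A :=
  forall C D, Fdiag C D -> n <= #|D| -> nfix A D = nfix A (repd C).

(** When [A] is F-generated, [(P, f)] has fixed points only if [f] is in [F], a condition unchanged
    by composing with F-isomorphisms; so comparison with the base points suffices. *)
Lemma F_stable_above A : F_generated F A -> F_stable F A <-> stable_above 0 A.
Proof.
move=> gA; split=> [sA C D [P [f [Ff <- def_C]]] _ | sA].
  have [P' def_P' iP'] := fhom_im_group Ff.
  have [f' [if' fK f'K]] := fiso_sym iP'.
  have /fclass_of_fiso[e ie] := etrans (rep_class C) (esym def_C).
  (* Composing [f] with [e] from [rep C] to [P] before and [e^-1 f^-1] after gives the identity of
     [rep C]. *)
  have := sA _ _ _ _ _ _ _ (fhom_injhom Ff) (esym def_P') ie (fiso_trans if' _).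
  have [e' [ie' eK e'K]] := fiso_sym ie.
  move=> /(_ _ _ ie') ->; congr #|'Fix_ _(_)|; apply/setP=> -[b a].
  rewrite !mem_tdiag; case aR: (a \in _) => //=.
  have eP : e a \in P by rewrite -(fiso_im ie) imset_f.
  by rewrite fK // eK.
have afixF P f : nfix A (tdiag P f) = if `[< fhom F P [set: gT] f >]
    then nfix A (repd (fclass_of F P)) else 0.
  case: asboolP => Ff; last by apply/eqP; rewrite eqn0Ngt; apply/negP=> /(F_generated_tdiag gA).
  exact: (sA _ (tdiag_group (fhom_injhom Ff)) (Fdiag_tdiag Ff)).
move=> P P' Q R f e1 e2 injf fP i1 i2.
rewrite (afixF P f) (afixF Q (e2 \o f \o e1)) (fiso_class i1).
congr (if _ then _ else _); apply: asbool_equiv_eq; split=> Ff.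
  apply: fhom_comp (fiso_fhom i1) _; apply: (fhom_comp (Q := P')).
    by apply: fhom_im Ff _; rewrite fP.
  exact: fhom_codom (subsetT _) (fiso_fhom i2).
have [e1' [i1' e1K e1'K]] := fiso_sym i1; have [e2' [i2' e2K e2'K]] := fiso_sym i2.
have e : {in P, f =1 e2' \o (e2 \o f \o e1) \o e1'}.
  by move=> x xP /=; rewrite e1'K // e2K // -fP imset_f.
rewrite (fhom_eq F _ e); apply: fhom_comp (fiso_fhom i1') _.
apply: (fhom_comp (Q := R)); last exact: fhom_codom (subsetT _) (fiso_fhom i2').
apply: fhom_im Ff _; rewrite imset_comp (fiso_im i1) imset_comp fP.
by rewrite (fiso_im i2).
Qed.

Variable p : nat.
Hypotheses (pS : p.-group [set: gT]) (satF : saturated F p).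

Lemma pgroup_square : p.-group [set: gT * gT].
Proof. by rewrite /pgroup cardsT card_prod pnatM -cardsT; apply/andP. Qed.

(** [be x al] embeds [N(D)] into [S x S] and takes [D] to [(P, id)]. A larger subgroup and its image
    are either both F-twisted diagonals of one class, where stability above [|D|] applies, or both
    without fixed points. *)
Lemma stable_above_transfer A C D P :
    F_generated F A -> Fdiag C D -> stable_above #|D|.+1 A ->
    fully_normalized F P -> fclass_of F P = C ->
  exists k, [/\ (nfix A D + k = nfix A (tdiag P id) + npts A D)%N,
    #|'N(D) : D| %| k & npts A (tdiag P id) <= k].
Proof.
move=> gA [Q [psi [Fpsi def_D def_C]]] sA fnP cP.
have PQ : P \in fclass F Q by apply/fclassP/fclass_of_fiso; rewrite def_C.
have [NB [al [be [Fal Fbe imal albe]]]] := tdiag_norm_extension pS satF fnP Fpsi PQ.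
rewrite def_D => sN.
have inN x : x \in 'N(D) -> x.1 \in NB /\ x.2 \in [group of 'N(Q)].
  by move/(subsetP sN); rewrite inE => /andP.
have phiM : {in 'N(D) &, {morph pairmap be al : x y / x * y}}.
  move=> x y /inN[x1 x2] /inN[y1 y2]; rewrite /pairmap /=.
  by rewrite (injhomM (fhom_injhom Fbe)) ?(injhomM (fhom_injhom Fal)).
pose phi := Morphism phiM.
have injphi : 'injm phi.
  apply/injmP=> -[x1 x2] [y1 y2] /inN[/= ? ?] /inN[/= ? ?] [e1 e2].
  have [_ Ial] := fhom_injhom Fal; have [_ Ibe] := fhom_injhom Fbe.
  by congr (_, _); auto.
have phiD : phi @* D = tdiag P id.
  rewrite morphimEsub ?normG //= -def_D -imset_comp /tdiag -imal -imset_comp.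
  by apply: eq_in_imset => x xQ; rewrite /pairmap /= -albe.
have := @afix_transfer _ A (biset_act A) p D phi pgroup_square injphi.
rewrite phiD; apply=> R pDR sRN; have phiR : phi @* R = pairmap be al @: R by rewrite morphimEsub.
have sR : R \subset setX NB [group of 'N(Q)] := subset_trans sRN sN.
have [[C' FR] | nFR] := pselect (exists C', Fdiag C' R).
  have FphiR : Fdiag C' [group of phi @* R] by rewrite /= phiR; apply: Fdiag_pairmap sR Fbe Fal.
  rewrite (sA C' R FR) ?proper_card // (sA C' _ FphiR) //=.
  by rewrite card_injm ?proper_card.
have [I def_I iI] := fhom_im_group Fal; have [al' [ial' alK _]] := fiso_sym iI.
have [J def_J iJ] := fhom_im_group Fbe; have [be' [ibe' beK _]] := fiso_sym iJ.
have Fal' := fhom_codom (subsetT _) (fiso_fhom ial').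
have Fbe' := fhom_codom (subsetT _) (fiso_fhom ibe').
transitivity 0; [|symmetry]; apply/eqP; rewrite eqn0Ngt; apply: contra_notN nFR.
  exact: F_generated_Fdiag.
case/(F_generated_Fdiag (D := [group of phi @* R]) gA) => C' FR; exists C'.
have -> : R = pairmap be' al' @: (phi @* R) :> {set _}.
  rewrite phiR -imset_comp -[LHS]imset_id; apply: eq_in_imset => -[b a] /(subsetP sR).
  by rewrite inE => /andP[/= ? ?]; rewrite /pairmap /= alK ?beK.
apply: Fdiag_pairmap FR _ Fbe' Fal'; rewrite /= phiR.
apply/subsetP=> _ /imsetP[x /(subsetP sR) + ->]; rewrite inE => /andP[? ?].
by rewrite inE /= def_I def_J !imset_f.
Qed.

End TwistedDiagonals.

(** * Construction of the minimal bisets *)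

Section MinimalBisets.

Variables (gT : finGroupType) (F : fusion_system gT).
Implicit Types (P Q : {group gT}) (D E R : {group gT * gT}) (C : fclasses F).
Implicit Types (A B : bisetType gT).
Variable p : nat.
Hypotheses (pS : p.-group [set: gT]) (satF : saturated F p).

Local Notation npts A Q := #|stabpts (biset_act A) Q|.
Local Notation nfix A Q := #|'Fix_(biset_act A)(Q)|.

(** A stage of the descending construction. The third clause already prescribes the final
    coordinates; the last one says that below order [n] there is only the initial orbit, which makes
    the next defects nonnegative. *)
Definition partial_omega C0 n A := [/\ F_generated F A, stable_above F n A,
  forall C, npts A (repd C) = ((C == C0) * #|'N(repd C) : repd C|)%N
  & forall D, #|D| < n -> 0 < npts A D -> exists x, D = repd C0 :^ x :> {set _}].

(** Above order [|S|] stability is vacuous, so a single orbit of type [repd C0] starts the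
    descent. *)
Lemma partial_omega_base C0 :
  exists A, partial_omega C0 #|[set: gT]|.+1 A.
Proof.
have e D : npts (incl_biset (rep C0)) D =
    (#|'N(D) : D| * [exists x, repd C0 :^ x == D])%N := stabpts_tbiset _ D.
have e1 D : 0 < npts (incl_biset (rep C0)) D -> exists x, D = repd C0 :^ x :> {set _}.
  by rewrite e; case: existsP => [[x /eqP <-] _ | _]; [exists x | rewrite muln0].
exists (incl_biset (rep C0)); split=> [|C D FD|C|D _]; last exact: e1.
- apply/F_generated_stabpts=> D /e1[x ->]; exists C0.
  exact: Fdiag_conj (Fdiag_repd C0).
- by rewrite (Fdiag_card FD) ltnNge subset_leq_card ?subsetT.
rewrite e mulnC; congr (nat_of_bool _ * _)%N; apply/existsP/eqP=> [[x /eqP e0] | ->].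
  apply: (Fdiag_inj (Fdiag_repd C)); rewrite -e0.
  exact: Fdiag_conj (Fdiag_repd C0).
by exists 1; rewrite conjsg1.
Qed.

(* At the classes of order n, repair the stability defect of D by adding
   (|Fix(repd C)| - |Fix(D)|) / |N(D) : D| copies of the orbit of type D. *)
Lemma partial_omega_step C0 n A :
  partial_omega C0 n.+1 A -> exists B, partial_omega C0 n B.
Proof.
case=> gA sA eA conjA.
pose defect C D := (nfix A (repd C) - nfix A D)%N.
have defectP C D : Fdiag C D -> #|D| = n ->
    nfix A D <= nfix A (repd C) /\ #|'N(D) : D| %| defect C D.
  move=> FD cD; rewrite /defect.
  have [|k [ek dk _]] := stable_above_transfer pS satF gA FD _ (@rep_fn _ F C) (rep_class C).
    by rewrite cD.
  (* Without points of stabilizer [D] the defect is the transfer constant [k]; otherwise [D] is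
     conjugate to [repd C0] and the defect vanishes. *)
  have [D0|] := posnP (npts A D); last first.
    case/conjA => [|x def_D]; first by rewrite cD.
    have -> : C = C0.
      by apply: Fdiag_inj FD _; rewrite def_D; apply: Fdiag_conj (Fdiag_repd C0).
    by rewrite def_D card_afixJ subnn.
  by move: ek; rewrite D0 addn0 -[tdiag _ _]/(repd C : {set _}) => <-; rewrite leq_addr addKn.
(* The class of [D] is unique, so the pick is unambiguous; other subgroups get multiplicity zero. *)
pose m D := if #|D| != n then 0 else
  if [pick C | `[< Fdiag C D >]] is Some C then defect C D %/ #|'N(D) : D| else 0.
have mn D : #|D| != n -> m D = 0 by rewrite /m => ->.
have mE C D : Fdiag C D -> #|D| = n -> (m D * #|'N(D) : D|)%N = defect C D.
  move=> FD cD; rewrite /m cD eqxx /=; case: pickP => [C' /asboolP FD' | /(_ C)/asboolP//].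
  by rewrite (Fdiag_inj FD' FD) divnK //; case: (defectP C D FD cD).
have mF D : 0 < m D -> exists C, Fdiag C D.
  by rewrite /m; case: ifP => // _; case: pickP => // C /asboolP FD _; exists C.
have [D D' x def_D' | D /mF[C [P [f [Ff e _]]]] | X eX] := @biset_with_orbits _ m.
- rewrite /m def_D' cardJg normJ indexJg.
  rewrite (@eq_pick _ _ (fun C => `[< Fdiag C D >])) => [|C].
    by case: ifP => // _; case: pickP => // C _; rewrite /defect def_D' card_afixJ.
  apply: asbool_equiv_eq; split=> [/(Fdiag_conj x^-1) | ]; first by rewrite conjsgK.
  exact: Fdiag_conj.
- by exists P, f; split=> //; apply: fhom_injhom Ff.
have Xn D : #|D| != n -> npts X D = 0 by move=> cD; rewrite eX mn.
(* All stabilizers in [X] have order [n], so a point fixed by a [D] of at least that order has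
   stabilizer exactly [D]. *)
have nfixX D : n <= #|D| -> nfix X D = npts X D.
  move=> cD; rewrite card_afixD1 ?subsetT // big1 ?addn0 // => R /proper_card ltDR.
  by rewrite Xn // gtn_eqF // (leq_ltn_trans cD).
(* The base points have defect zero, so the prescribed coordinates are kept. *)
have Xrepd C : npts X (repd C) = 0.
  have [cC | /Xn//] := eqVneq #|repd C| n.
  by rewrite eX (mE C) ?/defect ?subnn //; apply: Fdiag_repd.
exists (A + X)%type; split=> [|C D FD le_nD|C|D ltDn].
- apply/F_generated_stabpts=> D; rewrite stabpts_sum addn_gt0.
  case/orP; first by move/F_generated_stabpts: gA; apply.
  by rewrite eX muln_gt0 => /andP[/mF].
- have cC : #|repd C| = #|D| by rewrite (Fdiag_card FD) (Fdiag_card (Fdiag_repd C)).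
  rewrite !card_afix_sum !nfixX ?cC // Xrepd addn0.
  move: le_nD; rewrite leq_eqVlt => /orP[/eqP cD | ltnD]; last first.
    by rewrite (sA C) // Xn ?gtn_eqF // addn0.
  by rewrite eX (mE C) // subnKC //; case: (defectP C D FD (esym cD)).
- by rewrite stabpts_sum Xrepd addn0.
by rewrite stabpts_sum Xn ?ltn_eqF // addn0; apply: conjA; apply: ltnW.
Qed.

Lemma semichar_exists C0 : exists A : semichar_biset F,
  forall C, npts A (repd C) = ((C == C0) * #|'N(repd C) : repd C|)%N.
Proof.
have [A0 omA0] := partial_omega_base C0.
have [A [gA sA eA _]] : exists A, partial_omega C0 0 A.
  move: (_.+1) A0 omA0; elim=> [|n IHn] A omA; first by exists A.
  by have [B /IHn] := partial_omega_step omA.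
by exists (SemicharBiset (conj gA ((F_stable_above gA).2 sA))).
Qed.

Definition omega C : semichar_biset F := projT1 (cid (semichar_exists C)).

Lemma stabpts_omega C0 C :
  npts (omega C0) (repd C) = ((C == C0) * #|'N(repd C) : repd C|)%N.
Proof. by rewrite /omega; case: cid => A /= ->. Qed.

Lemma semichar_stable (A : semichar_biset F) : stable_above F 0 A.
Proof. by case: A => A [gA sA]; apply/F_stable_above. Qed.

(** Descending induction on [|D|]: stability ties the count at [D] to the one at its base point, up
    to larger stabilizers, where [A] and [B] already agree. *)
Lemma semichar_biso (A B : semichar_biset F) :
  (forall C, npts A (repd C) = npts B (repd C)) -> biso A B.
Proof.
move=> eAB; apply/stabpts_biso=> D.
have [gA _] := semicharP A; have [gB _] := semicharP B.
have [n] := ubnP (#|[set: gT * gT]| - #|D|); elim: n D => // n IHn D; rewrite ltnS => leDn.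
have above E : #|E| = #|D| ->
    (\sum_(R : {group gT * gT} | E \proper R) npts A R =
     \sum_(R : {group gT * gT} | E \proper R) npts B R)%N.
  move=> cE; apply: eq_bigr => R /proper_card ltER; apply: IHn.
  apply: leq_trans leDn; rewrite -cE; apply: ltn_sub2l => //.
  by rewrite (leq_trans ltER) ?subset_leq_card ?subsetT.
have [[C FD] | nFD] := pselect (exists C, Fdiag C D); last first.
  transitivity 0; [|symmetry]; apply/eqP; rewrite eqn0Ngt; apply: contra_notN nFD.
    by move: D {leDn above}; apply/F_generated_stabpts.
  by move: D {leDn above}; apply/F_generated_stabpts.
have := semichar_stable A FD (leq0n _); have := semichar_stable B FD (leq0n _).
rewrite !card_afixD1 ?subsetT // eAB !above ?(Fdiag_card FD) ?(Fdiag_card (Fdiag_repd C)) //.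
by move=> <- /addIn.
Qed.

(* As Fix(P, id) and Fix(P', id) have the same size, the k of the transfer from
   N(P', id) to N(P, id) is the right-hand side. *)
Lemma fully_normalized_stabpts (A : semichar_biset F) P P' :
    fully_normalized F P -> fclass_of F P' = fclass_of F P ->
  npts A (tdiag P id) <= npts A (tdiag P' id).
Proof.
move=> fnP cP; have [gA _] := semicharP A; have sA := semichar_stable A.
pose D Q := tdiag_group (injhom_incl Q).
have FD Q : Fdiag (fclass_of F Q) (D Q) := Fdiag_id F Q.
have [|k [+ _]] := stable_above_transfer pS satF gA (FD P') _ fnP (esym cP).
  by move=> C E FE _; apply: sA.
rewrite (sA _ _ (FD P')) // cP -(sA _ (D P) (FD P)) // => /eqP.
by rewrite eqn_add2l => /eqP->.
Qed.

End MinimalBisets.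

(** * Coordinates and the additive basis *)

Lemma additive_basis_free (T : Type) (zero : T) (add : Monoid.com_law zero)
    (I : finType) (b : I -> T) :
  additive_basis add b -> free_com_monoid add.
Proof.
move=> basis; exists I, (fun c : {ffun I -> nat} => lincomb add c b).
have /choice[coord coordP] : forall x, exists c : {ffun I -> nat},
    unique (fun c : {ffun I -> nat} => x = lincomb add c b) c.
  by move=> x; have [c ?] := basis x; exists c.
split=> [||c d].
- exists coord => [c|x]; last by have [<-] := coordP x.
  by have [_] := coordP (lincomb add c b); apply.
- by rewrite /lincomb big1 // => i _; rewrite ffunE.
rewrite /lincomb -big_split; apply: eq_bigr => i _; rewrite ffunE.
by elim: (c i) => [|n /= ->]; rewrite ?Monoid.mul1m ?Monoid.mulmA.
Qed.

Section Coordinates.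

Variables (gT : finGroupType) (F : fusion_system gT).
Implicit Types (P Q : {group gT}) (D : {group gT * gT}) (C : fclasses F).
Implicit Types (A B : semichar_biset F) (X Y : scclass F).
Variable p : nat.
Hypotheses (p_prime : prime p) (pS : p.-group [set: gT]) (satF : saturated F p).

Local Notation npts A Q := #|stabpts (biset_act A) Q|.
Local Notation nfix A Q := #|'Fix_(biset_act A)(Q)|.

(** The number of orbits of type [repd C]: each has [|N(repd C) : repd C|] points with exactly that
    stabilizer. *)
Definition coord A C := (npts A (repd C) %/ #|'N(repd C) : repd C|)%N.

Lemma coordK A C : (coord A C * #|'N(repd C) : repd C|)%N = npts A (repd C).
Proof. exact/divnK/dvdn_stabpts. Qed.

Lemma coord_omega C0 C : coord (omega pS satF C0) C = (C == C0).
Proof. by rewrite /coord stabpts_omega mulnK. Qed.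

Lemma coord_biso A B : biso A B <-> coord A =1 coord B.
Proof.
split=> [/stabpts_biso eAB C | eAB]; first by rewrite /coord eAB.
by apply: semichar_biso => C; rewrite -!coordK eAB.
Qed.

Lemma coord_union A B C : coord (sc_union A B) C = (coord A C + coord B C)%N.
Proof. by rewrite /coord stabpts_sum divnDl // dvdn_stabpts. Qed.

Lemma coord_empty C : coord (sc_empty F) C = 0.
Proof. by rewrite /coord stabpts_void div0n. Qed.

Definition sc_coord X := coord (sc_repr X).

Lemma sc_coord_of A : sc_coord (scclass_of A) =1 coord A.
Proof. by apply/coord_biso/scclass_eq; rewrite sc_reprK. Qed.

Lemma sc_coord_inj X Y : sc_coord X =1 sc_coord Y -> X = Y.
Proof. by move/coord_biso/scclass_eq; rewrite !sc_reprK. Qed.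

Lemma sc_coord_add X Y C : sc_coord (sc_add X Y) C = (sc_coord X C + sc_coord Y C)%N.
Proof. by rewrite /sc_add sc_coord_of coord_union. Qed.

(** Coordinates are additive and equal to Kronecker deltas on the [omega] classes, so they recover
    the coefficients. *)
Lemma sc_coord_lincomb (c : fclasses F -> nat) :
  sc_coord (lincomb (@sc_add gT F) c (fun C => scclass_of (omega pS satF C))) =1 c.
Proof.
move=> C; rewrite /lincomb.
have z : sc_coord (sc_zero F) C = 0 by rewrite sc_coord_of coord_empty.
rewrite (big_morph (sc_coord^~ C) (fun X Y => sc_coord_add X Y C) z).
have it C0 : sc_coord (iter (c C0) (sc_add (scclass_of (omega pS satF C0))) (sc_zero F)) C
    = (c C0 * (C == C0))%N.
  by elim: (c C0) => //= n IHn; rewrite sc_coord_add IHn sc_coord_of coord_omega.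
rewrite (eq_bigr _ (fun C0 _ => it C0)) (bigD1 C) //= eqxx muln1 big1 ?addn0 // => C0.
by rewrite eq_sym => /negPf->; rewrite muln0.
Qed.

Lemma omega_basis :
  additive_basis (@sc_add gT F) (fun C => scclass_of (omega pS satF C)).
Proof.
move=> X; exists [ffun C => sc_coord X C]; split.
  by apply: sc_coord_inj => C; rewrite sc_coord_lincomb ffunE.
by move=> c ->; apply/ffunP=> C; rewrite ffunE sc_coord_lincomb.
Qed.

(** [P] may differ from [rep C]; as [rep C] is fully normalized, the positive count there bounds the
    one at [P] from below. *)
Lemma omega_contains P : fully_normalized F P ->
  contains_orbit (incl_biset P) (omega pS satF (fclass_of F P)).
Proof.
move=> fnP; apply/contains_orbit_stabpts; set C := fclass_of F P.
have := fully_normalized_stabpts pS satF (omega pS satF C) (@rep_fn _ F C) (esym (rep_class C)).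
apply: leq_trans; rewrite -[tdiag _ _]/(repd C : {set _}) stabpts_omega eqxx mul1n.
exact: indexg_gt0.
Qed.

(** The given orbit forces a positive coordinate at the class of [P], so one copy of [omega] splits
    off; [B] collects the remaining coordinates. *)
Lemma omega_minimal P A : fully_normalized F P ->
  contains_orbit (incl_biset P) A -> bsub (omega pS satF (fclass_of F P)) A.
Proof.
move=> fnP /contains_orbit_stabpts; set C := fclass_of F P => Pgt0.
have cA : 0 < coord A C.
  rewrite -(ltn_pmul2r (indexg_gt0 'N(repd C) (repd C))) mul0n coordK.
  exact: leq_trans Pgt0 (fully_normalized_stabpts pS satF A fnP (rep_class C)).
pose B := sc_repr (lincomb (@sc_add gT F) (fun C' => coord A C' - (C' == C))%N
  (fun C => scclass_of (omega pS satF C))).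
have /biso_sym[h [hl hr] /bij_inj hI] : biso A (sc_union (omega pS satF C) B).
  apply/coord_biso=> C'; rewrite coord_union coord_omega -[coord B C']/(sc_coord _ C').
  rewrite sc_coord_lincomb subnKC //.
  by case: eqP => // ->.
exists (h \o inl) => [|x y /hI[]//].
by split=> [b w | w a] /=; rewrite -?hl -?hr.
Qed.

(** * Counting points modulo p *)

Local Notation S := [set: gT].

Lemma setT_fully_normalized : fully_normalized F [group of S].
Proof. by move=> Q _; apply: subset_leq_card; rewrite (subset_trans (subsetT _)) ?normG. Qed.

Let CS := fclass_of F [group of S].

Lemma rep_setT : rep CS = [group of S].
Proof.
have [f iS] := fclass_of_fiso (rep_class CS).
by apply/val_inj/eqP; rewrite eqEcard subsetT /= (fiso_card iS).
Qed.

(** The normalizer of the diagonal consists of the pairs [(z x, x)] with [z] central in [S]. *)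
Lemma index_norm_setT : #|'N(repd CS) : repd CS| = #|'Z(S)|.
Proof.
rewrite -divgS ?normG //= rep_setT card_tdiag.
suff -> : #|'N(tdiag S id)| = (#|'Z(S)| * #|S|)%N by rewrite mulnK.
rewrite -cardsX -(card_imset _ (_ : injective (fun x : gT * gT => (x.1 * x.2, x.2)))).
  apply: eq_card => -[b a]; apply/idP/imsetP=> [/normP nba | [[z x]]].
    exists (b * a^-1, a); rewrite /= ?mulgKV // !inE /= andbT.
    apply/centP=> x _; apply/commute_sym/commgP/conjg_fixP.
    have : (x ^ b, x ^ a) \in tdiag S id.
      rewrite -nba -[(x ^ b, x ^ a)]/((x, x) ^ (b, a)) memJ_conjg.
      by rewrite (mem_tdiag [group of S]) inE /=.
    by rewrite (mem_tdiag [group of S]) inE /= conjgM => /eqP->; rewrite conjgK.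
  rewrite !inE /= andbT => zZ [-> ->]; apply/subsetP=> _ /imsetP[_ /imsetP[y _ ->] ->].
  rewrite -[_ ^ _]/(y ^ (z * x), y ^ x) (mem_tdiag [group of S]) inE /= conjgM.
  have -> // : y ^ z = y by apply/conjg_fixP/commgP/commute_sym/(centP zZ); rewrite inE.
by move=> [z x] [z' x'] [+ e]; rewrite e => /mulIg ->.
Qed.

(** No stabilizer has order above [|S|], so here fixed points are the points with that stabilizer,
    and stability passes from [a] to the identity. *)
Lemma stabpts_setT A (a : {perm gT}) : a \in AutF F [group of S] ->
  npts A (tdiag S a) = (coord A CS * #|'Z(S)|)%N.
Proof.
move=> aF; have Fa : fhom F [group of S] S a by case/setIdP: aF.
have top D : Fdiag CS D -> nfix A D = npts A D.
  move=> FD; rewrite card_afixD1 ?subsetT // big1 ?addn0 // => R pDR; apply/eqP.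
  rewrite eqn0Ngt; apply/negP.
  case/((F_generated_stabpts F A).1 (semicharP A).1 R) => C FR.
  have := proper_card pDR; rewrite (Fdiag_card FR) (Fdiag_card FD) rep_setT ltnNge.
  by rewrite subset_leq_card ?subsetT.
pose D := tdiag_group (fhom_injhom Fa); have FD : Fdiag CS D := Fdiag_tdiag Fa.
rewrite -index_norm_setT coordK -[tdiag _ _]/(D : {set _}) -(top D FD) -(top _ (Fdiag_repd CS)).
exact: (semichar_stable A FD).
Qed.

Lemma card_full_stabilizer A :
  #|[set w : A | #|'C[w | biset_act A]| == #|S|]| =
  (#|AutF F [group of S]| * (coord A CS * #|'Z(S)|))%N.
Proof.
rewrite -sum_nat_const -(eq_bigr _ (fun a aF => stabpts_setT A aF)) -sum1_card.
(* Each of these points has stabilizer [(S, a)] for exactly one [a] in [Aut_F(S)]. *)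
transitivity (\sum_(w in [set w : A | #|'C[w | biset_act A]| == #|S|])
    \sum_(a in AutF F [group of S]) ('C[w | biset_act A] == tdiag S a : nat))%N.
  apply: eq_bigr => w; rewrite inE => /eqP cw.
  have [P [f [Ff e]]] := (semicharP A).1 w.
  have PT : P = [group of S].
    by apply/val_inj/eqP; rewrite eqEcard subsetT /= -cw e card_tdiag.
  rewrite PT in Ff e; have [mf If] := fhom_injhom Ff.
  have If' : injective f by move=> x y; apply: If; rewrite inE.
  have aF : perm If' \in AutF F [group of S].
    have fE : {in [group of S], perm If' =1 f} by move=> x _; rewrite permE.
    rewrite inE (fhom_eq F _ fE) Ff andbT inE; apply/andP; split.
      by apply/subsetP=> x _; rewrite inE.
    by apply/morphicP=> x y _ _; rewrite !permE (injhomM (fhom_injhom Ff)) ?inE.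
  rewrite (bigD1 _ aF) /= e [_ == _](_ : _ = true) => [|]; last first.
    by apply/eqP/eq_imset => x; rewrite permE.
  rewrite big1 // => a /andP[_ ne]; apply/eqP; rewrite eqb0; apply: contra ne => /eqP efa.
  have /tdiag_subP[_ fa] : tdiag [group of S] f \subset tdiag [group of S] a by rewrite -efa.
  by apply/eqP/permP=> x; rewrite permE fa ?inE.
rewrite exchange_big; apply: eq_bigr => a _ /=; rewrite -[RHS]sum1_card.
rewrite big_mkcond [RHS]big_mkcond; apply: eq_bigr => w _; rewrite !inE.
by case: ('C[w | _] =P tdiag S a) => [->|_]; rewrite ?(card_tdiag [group of S]) ?eqxx // if_same.
Qed.

(** An orbit with stabilizer [(P, f)] has [|S| |S : P|] points, and [p] divides [|S : P|] when [P]
    is proper. *)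
Lemma dvdn_card_small_stabilizer A :
  (p * #|S|)%N %| #|[set w : A | #|'C[w | biset_act A]| != #|S|]|.
Proof.
set V := [set w | _]; have actV : [acts [set: gT * gT], on V | biset_act A].
  by apply/actsP=> x _ w; rewrite !inE astab1_act cardJg.
rewrite -(acts_sum_card_orbit actV); apply: dvdn_sum => _ /imsetP[w wV ->].
have [P [f [Ff e]]] := (semicharP A).1 w.
move: wV; rewrite inE e card_tdiag => nP.
have := card_orbit_stab (biset_act A) [group of [set: gT * gT]] w.
rewrite /= setTI e card_tdiag cardsT card_prod -!cardsT => cO.
have LP := Lagrange (subsetT P).
have : (#|orbit (biset_act A) [set: gT * gT] w| * #|P| = #|S| * #|S : P| * #|P|)%N.
  by rewrite cO -{2}LP mulnAC mulnA.
move/eqP; rewrite eqn_pmul2r // => /eqP->; rewrite mulnC dvdn_pmul2l //.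
have : p.-nat #|S : P| := pnat_dvd (dvdn_indexg _ _) pS.
case/p_natP=> // -[|i] e1; last by rewrite e1 expnS dvdn_mulr.
by move: nP; rewrite -LP e1 muln1 eqxx.
Qed.

(** As [S] is fully normalized, [Aut_S(S) = Inn(S)] is Sylow in [Aut_F(S)], so [p] does not divide
    [|Out_F(S)|]. *)
Lemma characteristic_coord A : F_characteristic F p A <-> ~~ (p %| coord A CS).
Proof.
have [_ sylS] := satF.1 _ setT_fully_normalized.
have [sSF _ p'ix] := and3P sylS.
have nT : 'N(S) = S by apply/eqP; rewrite eqEsubset subsetT normG.
have cS : (#|AutS [group of S]| * #|'Z(S)| = #|S|)%N.
  rewrite /AutS card_morphim ker_conj_aut /= nT setIid mulnC /center setTI.
  by rewrite Lagrange ?subsetT.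
have [t ct] := dvdnP (dvdn_card_small_stabilizer A).
(* The points with stabilizer of order [|S|] give the first term, since [|Inn(S)| |Z(S)| = |S|]; all
   others give a multiple of [p |S|]. *)
have cA : #|A| = (#|S| * (#|AutF F [group of S] : AutS [group of S]| * coord A CS + p * t))%N.
  rewrite -cardsT -(cardsID [set w : A | #|'C[w | biset_act A]| == #|S|]) setTI.
  rewrite card_full_stabilizer mulnDr; congr (_ + _)%N.
    by rewrite -(Lagrange sSF) -cS [RHS]mulnACA [X in _ = (_ * X)%N]mulnC.
  rewrite [RHS]mulnC [RHS]mulnAC [RHS]mulnC -ct.
  by apply: eq_card => w; rewrite !inE andbT.
have [gA sA] := semicharP A.
rewrite /F_characteristic cA mulKn ?cardG_gt0 // (dvdn_addl _ (dvdn_mulr t (dvdnn p))).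
rewrite Euclid_dvdM // negb_or -p'natE // p'ix /=.
by split=> [[] | ?] //; split.
Qed.

End Coordinates.

Theorem theorem5p3 (p : nat) (gT : finGroupType) (F : fusion_system gT)
    (p_prime : prime p) (pS : p.-group [set: gT]) (satF : saturated F p) :
  exists Omega : fclasses F -> semichar_biset F,
    [/\ forall P : {group gT}, fully_normalized F P ->
          contains_orbit (incl_biset P) (Omega (fclass_of F P)) /\
          (forall A : semichar_biset F, contains_orbit (incl_biset P) A ->
             bsub (Omega (fclass_of F P)) A),
        additive_basis (@sc_add gT F) (fun C => scclass_of (Omega C)),
        free_com_monoid (@sc_add gT F)
      & forall (A : semichar_biset F) (c : fclasses F -> nat),
          scclass_of A = lincomb (@sc_add gT F) c (fun C => scclass_of (Omega C)) ->
          (F_characteristic F p A <-> ~~ (p %| c (fclass_of F [set: gT]%G)))].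
Proof.
have basis := omega_basis pS satF.
exists (omega pS satF); split=> // [P fnP | | A c e].
- by split=> [|A]; [apply: omega_contains | apply: omega_minimal].
- exact: additive_basis_free basis.
have := sc_coord_lincomb pS satF c (fclass_of F [set: gT]%G); rewrite -e sc_coord_of => <-.
exact: characteristic_coord p_prime pS satF A.
Qed.
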